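(* Let $(T,\preceq,\Sigma,\mathcal S,\mathcal M)$ be an $(\mathcal S,\mathcal M)$-tree and let $\mathcal R$ be the space of infinite fat subtrees with the Ellentuck topology. Then every subset of $\mathcal R$ with the property of Baire is Ramsey, and every meager subset of $\mathcal R$ is Ramsey null.
   Context: A tree is a partially ordered set $(T,\preceq)$ such that for every $a\in T$ the set $\{b\in T:b\prec a\}$ is finite and linearly ordered by $\preceq$. The level of $a$ is $\ell(a)=|\{b\in T:b\prec a\}|$; $T(n)=\{a\in T:\ell(a)=n\}$, and $T(\le n)$, $T(<n)$ are defined analogously. A node $b$ is an immediate successor of $a$ if $a\prec b$ and there is no $c$ with $a\prec c\prec b$. An $\mathcal S$-tree is a quadruple $(T,\preceq,\Sigma,\mathcal S)$ where $(T,\preceq)$ is a countable tree in which every node has finitely many immediate successors and $T(0)$ is finite, $\Sigma$ is a set, and $\mathcal S\colon T\times T^{<\omega}\times\Sigma\to T$ is a partial function such that: (S1) if $\mathcal S(a,\bar p,c)$ is defined then it is an immediate successor of $a$ and every entry of $\bar p$ has level at most $\ell(a)-1$; (S2) if $\mathcal S(a,\bar p,c)=\mathcal S(b,\bar q,d)$ then $a=b$, $\bar p=\bar q$ and $c=d$; (S3) for every $a\in T$ and every immediate successor $b$ of $a$ there are $\bar p\in T^{<\omega}$ and $c\in\Sigma$ with $b=\mathcal S(a,\bar p,c)$. For $S\subseteq T$, a map $f\colon S\to T$ is level-preserving if $\ell(a)=\ell(b)$ implies $\ell(f(a))=\ell(f(b))$; then $\tilde f(n)$ denotes $\ell(f(a))$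 for any $a\in S$ with $\ell(a)=n$. An injection $F\colon T\to T$ is shape-preserving if (i) it is level-preserving; (ii) whenever $\mathcal S(a,\bar p,c)$ is defined, $\mathcal S(F(a),F(\bar p),c)$ is defined and $\mathcal S(F(a),F(\bar p),c)\preceq F(\mathcal S(a,\bar p,c))$, where $F(\bar p)$ is the tuple of images of the entries of $\bar p$; (iii) for every $a\in T(0)$ and $b\in T$ with $a\preceq b$ we have $a\preceq F(b)$. A shape-preserving $F$ skips level $m$ if $m\notin\tilde F[\omega]$, and skips only level $m$ if $\tilde F[\omega]=\omega\setminus\{m\}$. An $(\mathcal S,\mathcal M)$-tree is a quintuple $(T,\preceq,\Sigma,\mathcal S,\mathcal M)$ where $(T,\preceq,\Sigma,\mathcal S)$ is an $\mathcal S$-tree and $\mathcal M$ is a set of shape-preserving functions $T\to T$ such that: (M1) $\mathrm{Id}_T\in\mathcal M$, $\mathcal M$ is closed under composition, and whenever $(F_i)_{i\in\omega}$ is a sequence in $\mathcal M$ with $F_i\restriction T(\le i)=F_{i+1}\restriction T(\le i)$ for all $i$, there is $F_\infty\in\mathcal M$ with $F_\infty\restriction T(\le i)=F_i\restriction T(\le i)$ for all $i$; (M2) for every $n\in\omega$ and every $F\in\mathcal M$ with $\tilde F(n)>0$ which skips level $\tilde F(n)-1$, there are $F_1,F_2\in\mathcal M$ such that $F_2$ skips only level $\tilde F(n)-1$ and $(F_2\circ F_1)\restriction T(\le n)=F\restriction T(\le n)$; (M3) for all $n<m$ in $\omega$ there is $F^n_m\in\mathcal M$ skipping only level $m$ such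 that $F^n_m(b)=\mathcal S(b,\bar p,c)$ whenever $a\in T(n)$, $b\in T(m)$, $\bar p\in T^{<\omega}$, $c\in\Sigma$, $\mathcal S(a,\bar p,c)$ is defined and $\mathcal S(a,\bar p,c)\preceq b$. Notation: $\mathcal M^n=\{F\in\mathcal M: F\restriction T(<n)\text{ is the identity}\}$; $\mathcal{AM}=\{F\restriction T(<k): F\in\mathcal M,\ k>0\}$; $\mathcal{AM}^n_k=\{F\restriction T(<n+k):F\in\mathcal M^n\}$; $\mathcal{AM}^n_k(m)=\{f\in\mathcal{AM}^n_k:\tilde f(n+k-1)=m\}$. For $f\in\mathcal{AM}$ with domain $T(\le n)$, its canonical extension $f^+$ is the unique $f^+\in\mathcal M$ with $f^+\restriction T(\le n)=f$ and $\ell\in\tilde{f^+}[\omega]$ for all $\ell\ge\tilde f(n)$ (it exists and is unique). Fat subtrees: for $n\in\omega+1$, a fat subtree of height $n$ is a sequence $\mathbf U=(u_i)_{i\in n}$ of elements of $\mathcal{AM}$ for which there is a (necessarily unique) cut function $c_{\mathbf U}\colon\min(n+1,\omega)\to\omega$ with $c_{\mathbf U}(0)=0$ and $u_\ell\in\mathcal{AM}^{c_{\mathbf U}(\ell)}_1(c_{\mathbf U}(\ell+1)-1)$ for every $\ell<n$. For levels $0\le\ell\le k\le n$ (with $k<\omega$) and nonempty $X\subseteq T(c_{\mathbf U}(\ell))$, the lift $\mathrm{Lift}_{\mathbf U}(X,\ell,k)\subseteq T(c_{\mathbf U}(k))$ is defined recursively: it is $X$ if $\ell=k$, and if $\ell<k$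 it is $\mathrm{Lift}_{\mathbf U}(u_\ell^+[N],\ell+1,k)$, where $N$ is the set of all immediate successors of nodes of $X$. Write $\mathrm{Lift}_{\mathbf U}(\ell,k)=\mathrm{Lift}_{\mathbf U}(T(c_{\mathbf U}(\ell)),\ell,k)$. For fat subtrees $\mathbf V=(v_i)_{i\in m}$ and $\mathbf U=(u_i)_{i\in m'}$, $\mathbf V\le\mathbf U$ means there is $\varphi\colon\min(m+1,\omega)\to\min(m'+1,\omega)$ such that for every $\ell<m$: $c_{\mathbf V}(\ell)=c_{\mathbf U}(\varphi(\ell))$ and $\mathrm{Lift}_{\mathbf V}(\ell,\ell+1)\subseteq\mathrm{Lift}_{\mathbf U}(\varphi(\ell),\varphi(\ell+1))$. $\mathcal R$ is the set of fat subtrees of height $\omega$ and $\mathcal{AR}$ the set of fat subtrees of finite height. The Ellentuck topology on $\mathcal R$ is generated by the basic sets $[\mathbf x,\mathbf U]=\{\mathbf V\in\mathcal R:\mathbf V\le\mathbf U\text{ and }\mathbf x\text{ is an initial segment of }\mathbf V\}$ for $\mathbf x\in\mathcal{AR}$, $\mathbf U\in\mathcal R$. For $n\in\omega$, $[n,\mathbf U]=[\mathbf U\restriction n,\mathbf U]$ where $\mathbf U\restriction n$ is the initial segment of length $n$. For $\mathbf x\in\mathcal{AR}$ of height $|\mathbf x|$, $\mathrm{depth}_{\mathbf U}(\mathbf x)$ is the unique $n$ with $c_{\mathbf U}(n)=c_{\mathbf x}(|\mathbf x|)$ if $\mathbf x\le\mathbf U$, and $\omega$ otherwise. A set $\mathcal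 X\subseteq\mathcal R$ is Ramsey if for every nonempty $[\mathbf x,\mathbf U]$ there is $\mathbf U'\in[\mathrm{depth}_{\mathbf U}(\mathbf x),\mathbf U]$ with $[\mathbf x,\mathbf U']\subseteq\mathcal X$ or $[\mathbf x,\mathbf U']\cap\mathcal X=\emptyset$; it is Ramsey null if always the second alternative can be achieved. *)

(* Defs.v *)
From Stdlib Require Import List Arith.
Import ListNotations.

Record Sdata := {
  node : Type;
  tle : node -> node -> Prop;
  lev : node -> nat;
  sig : Type;
  Sf : node -> list node -> sig -> option node
}.

Arguments tle {s} _ _.
Arguments lev {s} _.
Arguments Sf {s} _ _ _.

Section Defs.
Context {D : Sdata}.

Definition strict (a b : node D) : Prop := tle a b /\ a <> b.

Definition imm_succ (a b : node D) : Prop :=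
  strict a b /\ ~ (exists c, strict a c /\ strict c b).

Definition is_tree : Prop :=
  (forall a : node D, tle a a) /\
  (forall a b : node D, tle a b -> tle b a -> a = b) /\
  (forall a b c : node D, tle a b -> tle b c -> tle a c) /\
  (forall a : node D, exists l : list (node D),
      NoDup l /\ length l = lev a /\ (forall b, In b l <-> strict b a)) /\
  (forall a b c : node D, strict b a -> strict c a -> tle b c \/ tle c b).

Definition is_Stree : Prop :=
  is_tree /\
  (exists f : node D -> nat, forall a b, f a = f b -> a = b) /\
  (forall a : node D, exists l, forall b, imm_succ a b -> In b l) /\
  (exists l : list (node D), forall a, lev a = 0 -> In a l) /\
  (forall a p c b, Sf a p c = Some b ->
      imm_succ a b /\ forall q, In q p -> lev q + 1 <= lev a) /\
  (forall (a : node D) p c a' p' c' b, Sf a p c = Some b -> Sf a' p' c' = Some b ->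
      a = a' /\ p = p' /\ c = c') /\
  (forall a b, imm_succ a b -> exists p c, Sf a p c = Some b).

Definition level_preserving (F : node D -> node D) : Prop :=
  forall a b, lev a = lev b -> lev (F a) = lev (F b).

Definition shape_preserving (F : node D -> node D) : Prop :=
  (forall a b, F a = F b -> a = b) /\
  level_preserving F /\
  (forall a p c b, Sf a p c = Some b ->
     exists b', Sf (F a) (map F p) c = Some b' /\ tle b' (F b)) /\
  (forall a b, lev a = 0 -> tle a b -> tle a (F b)).

Definition skips (F : node D -> node D) (m : nat) : Prop :=
  ~ (exists a, lev (F a) = m).

Definition skips_only (F : node D -> node D) (m : nat) : Prop :=
  forall l, (exists a, lev (F a) = l) <-> l <> m.

Definition is_SMtree (M : (node D -> node D) -> Prop) : Prop :=
  is_Stree /\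
  (forall F, M F -> shape_preserving F) /\
  M (fun a => a) /\
  (forall F G, M F -> M G -> M (fun a => F (G a))) /\
  (forall Fs : nat -> node D -> node D,
     (forall i, M (Fs i)) ->
     (forall i a, lev a <= i -> Fs i a = Fs (S i) a) ->
     exists Finf, M Finf /\ forall i a, lev a <= i -> Finf a = Fs i a) /\
  (forall n F a, M F -> lev a = n -> 0 < lev (F a) -> skips F (lev (F a) - 1) ->
     exists F1 F2, M F1 /\ M F2 /\ skips_only F2 (lev (F a) - 1) /\
       forall b, lev b <= n -> F2 (F1 b) = F b) /\
  (forall n m, n < m -> exists F, M F /\ skips_only F m /\
     forall a b p c s, lev a = n -> lev b = m -> Sf a p c = Some s -> tle s b ->
       Sf b p c = Some (F b)).

(* A finite approximation F|T(<k) is represented by its graph, i.e. the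
   partial function that is undefined outside its domain. *)
Definition approx := node D -> option (node D).

Definition noapprox : approx := fun _ => None.

Variable M : (node D -> node D) -> Prop.

Definition in_AMn1 (n m : nat) (u : approx) : Prop :=
  exists F, M F /\ (forall a, lev a < n -> F a = a) /\
    (forall a, u a = if lev a <=? n then Some (F a) else None) /\
    (forall a, lev a = n -> lev (F a) = m).

(* c is the cut function of the sequence V on the index set inV
   (inV l := l < height). *)
Definition is_cut (inV : nat -> Prop) (V : nat -> approx) (c : nat -> nat) : Prop :=
  c 0 = 0 /\
  forall l, inV l -> 0 < c (S l) /\ in_AMn1 (c l) (c (S l) - 1) (V l).

Definition allnat : nat -> Prop := fun _ => True.

Definition Rsp (V : nat -> approx) : Prop := exists c, is_cut allnat V c.

Definition seq_of (x : list approx) : nat -> approx := fun i => nth i x noapprox.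
Definition below_len (x : list approx) : nat -> Prop := fun l => l < length x.

Definition ARsp (x : list approx) : Prop := exists c, is_cut (below_len x) (seq_of x) c.

Definition canext (n : nat) (u : approx) (G : node D -> node D) : Prop :=
  M G /\ (forall a, lev a <= n -> u a = Some (G a)) /\
  (forall a l, lev a = n -> lev (G a) <= l -> exists b, lev (G b) = l).

Definition levset (n : nat) : node D -> Prop := fun a => lev a = n.

Definition lift_step (U : nat -> approx) (c : nat -> nat) (X : node D -> Prop)
  (l : nat) : node D -> Prop :=
  fun y => exists G, canext (c l) (U l) G /\
    exists a b, X a /\ imm_succ a b /\ y = G b.

(* Lift_U(X, l, l + d) *)
Fixpoint Lift (U : nat -> approx) (c : nat -> nat) (X : node D -> Prop)
  (l d : nat) : node D -> Prop :=
  match d with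
  | 0 => X
  | S d' => Lift U c (lift_step U c X l) (S l) d'
  end.

Definition fat_le (inV : nat -> Prop) (V U : nat -> approx) : Prop :=
  exists cV cU (phi : nat -> nat),
    is_cut inV V cV /\ is_cut allnat U cU /\
    forall l, inV l ->
      cV l = cU (phi l) /\ phi l <= phi (S l) /\
      forall y, Lift V cV (levset (cV l)) l 1 y ->
                Lift U cU (levset (cU (phi l))) (phi l) (phi (S l) - phi l) y.

Definition rset := (nat -> approx) -> Prop.
Definition sub (A B : rset) : Prop := forall V, A V -> B V.

Definition basic (x : list approx) (U : nat -> approx) : rset :=
  fun V => Rsp V /\ fat_le allnat V U /\
    forall i, i < length x -> nth i x noapprox = V i.

Definition fin_int (l : list (list approx * (nat -> approx))) : rset :=
  fun V => Rsp V /\ Forall (fun p => basic (fst p) (snd p) V) l.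

Definition Eopen (O : rset) : Prop :=
  sub O Rsp /\
  forall V, O V -> exists l,
    Forall (fun p => ARsp (fst p) /\ Rsp (snd p)) l /\
    fin_int l V /\ sub (fin_int l) O.

Definition interior (A : rset) : rset :=
  fun V => exists O, Eopen O /\ sub O A /\ O V.

Definition closure (A : rset) : rset :=
  fun V => Rsp V /\ forall O, Eopen O -> O V -> exists W, O W /\ A W.

Definition nowhere_dense (N : rset) : Prop :=
  sub N Rsp /\ forall V, ~ interior (closure N) V.

Definition meager (A : rset) : Prop :=
  sub A Rsp /\ exists Ns : nat -> rset,
    (forall i, nowhere_dense (Ns i)) /\ forall V, A V -> exists i, Ns i V.

Definition has_Baire (A : rset) : Prop :=
  sub A Rsp /\ exists O, Eopen O /\
    meager (fun V => (A V /\ ~ O V) \/ (O V /\ ~ A V)).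

(* U' \in [depth_U(x), U] *)
Definition in_depth_cone (x : list approx) (U U' : nat -> approx) : Prop :=
  Rsp U' /\ fat_le allnat U' U /\
  (fat_le (below_len x) (seq_of x) U ->
     exists n cx cU, is_cut (below_len x) (seq_of x) cx /\ is_cut allnat U cU /\
       cU n = cx (length x) /\ forall i, i < n -> U' i = U i) /\
  (~ fat_le (below_len x) (seq_of x) U -> forall i, U' i = U i).

Definition Ramsey (X : rset) : Prop :=
  forall x U, ARsp x -> Rsp U -> (exists V, basic x U V) ->
    exists U', in_depth_cone x U U' /\
      (sub (basic x U') X \/ forall V, basic x U' V -> ~ X V).

Definition Ramsey_null (X : rset) : Prop :=
  forall x U, ARsp x -> Rsp U -> (exists V, basic x U V) ->
    exists U', in_depth_cone x U U' /\ forall V, basic x U' V -> ~ X V.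

End Defs.

(* Main.v *)
Require Import Defs.
From Stdlib Require Import List Arith Lia Classical ClassicalEpsilon FunctionalExtensionality.
Import ListNotations.

(** A fat subtree is an infinite path of edges k -> m, an edge being an element of AM^k_1(m-1),
    and V <= U holds when each edge of V lies inside a segment of U. So tails and finite prefixes
    can be exchanged freely, there are finitely many edges between two levels, and the Ellentuck
    theorem follows by accept/reject forcing and fusion, once one has the pigeonhole principle: for
    every 2-colouring of the edges starting at the first level k0 of a path U, some V <= U has all
    its one-edge approximations from k0 in one colour.

    For the pigeonhole, suppose that every V <= U contains an edge of colour P. For a set Q of
    morphisms k0 -> k call h good if h o v has colour P for all v in Q. If, in every tree from k
    below a given one, some h is good for Q, then some good w has the same property for the set of
    all one-letter extensions of the morphisms w o v, in some smaller tree; iterating w gives V.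
    Otherwise, by fusion, no good w has any good continuation h in some U', and one builds a tree
    below U' without good h. The next block t of that tree must make t o e bad for each of the
    finitely many prefixes e inside U' that end where t starts. If no t does, colour every t by some e with t o e good.
    The maps of (M3) append copies of letters seen earlier, so words over such letters code maps t,
    and the Hales-Jewett theorem yields a word w and a variable word z(x) with w and all
    w.n.z(n) of the same colour e. Then w o e is good and z is a good continuation of it. This
    requires that every letter that can ever follow e o v has already been placed somewhere, which
    is arranged beforehand. *)

(** * Choice principles *)

Lemma functional_choice_on (A B : Type) (R : A -> B -> Prop) :
  (forall a, exists b, R a b) -> exists f : A -> B, forall a, R a (f a).
Proof.
  intros H.
  exists (fun a => proj1_sig (constructive_indefinite_description _ (H a))).
  intros a. exact (proj2_sig (constructive_indefinite_description _ (H a))).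
Qed.

Lemma dependent_choice (A : Type) (P : nat -> A -> Prop) (R : nat -> A -> A -> Prop) (a0 : A) :
  P 0 a0 -> (forall n a, P n a -> exists a', P (S n) a' /\ R n a a') ->
  exists f : nat -> A, f 0 = a0 /\ forall n, P n (f n) /\ R n (f n) (f (S n)).
Proof.
  intros H0 Hs.
  (* The step relation is made total by allowing any value where the invariant fails, so that plain
     choice applies. *)
  assert (Hs' : forall na : nat * A, exists a',
             P (fst na) (snd na) -> P (S (fst na)) a' /\ R (fst na) (snd na) a').
  { intros [n a]. destruct (classic (P n a)) as [h|h].
    - destruct (Hs n a h) as [a' ?]. exists a'. auto.
    - exists a. intros; contradiction. }
  destruct (functional_choice_on _ _ _ Hs') as [g Hg].
  set (f := nat_rect (fun _ => A) a0 (fun n a => g (n, a))).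
  assert (HP : forall n, P n (f n)).
  { induction n as [|n IH]; [exact H0|]. apply (Hg (n, f n)). exact IH. }
  exists f. split; [reflexivity|]. intros n. split; [apply HP|].
  apply (Hg (n, f n)). apply HP.
Qed.

(** * The Hales-Jewett theorem *)

Fixpoint words {X : Type} (A : list X) (n : nat) : list (list X) :=
  match n with
  | 0 => [[]]
  | S n' => flat_map (fun x => map (cons x) (words A n')) A
  end.

Lemma in_words {X : Type} (A : list X) n y : In y (words A n) <-> length y = n /\ incl y A.
Proof.
  revert y. induction n as [|n IH]; intros y; simpl.
  - split.
    + intros [<-|[]]. split; [reflexivity|]. intros x [].
    + intros [H _]. destruct y; [auto|discriminate].
  - rewrite in_flat_map. split.
    + intros (x & Hx & Hy). apply in_map_iff in Hy. destruct Hy as (y' & <- & Hy).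
      apply IH in Hy. destruct Hy as [L Hi]. split; [simpl; lia|].
      apply incl_cons; auto.
    + intros [L Hi]. destruct y as [|x y]; [discriminate|].
      exists x. split; [apply Hi; left; auto|]. apply in_map, IH.
      split; [simpl in L; lia|]. eapply incl_cons_inv; eauto.
Qed.

Lemma length_words {X : Type} (A : list X) n : length (words A n) = length A ^ n.
Proof.
  induction n as [|n IH]; simpl; [reflexivity|].
  rewrite (flat_map_constant_length (c := length A ^ n)); [reflexivity|].
  intros x _. rewrite length_map. exact IH.
Qed.

(* A variable word: [None] is the variable. *)
Definition subst (n : nat) (z : list (option nat)) : list nat :=
  map (fun o => match o with Some x => x | None => n end) z.

Definition vover (A : list nat) (z : list (option nat)) : Prop := forall x, In (Some x) z -> In x A.

Lemma subst_app n z z' : subst n (z ++ z') = subst n z ++ subst n z'.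
Proof. apply map_app. Qed.

Lemma subst_const n y : subst n (map Some y) = y.
Proof. unfold subst. rewrite map_map, map_id. reflexivity. Qed.

Lemma length_subst n z : length (subst n z) = length z.
Proof. apply length_map. Qed.

Lemma subst_over A n z : vover A z -> In n A -> incl (subst n z) A.
Proof.
  intros H Hn x Hx. apply in_map_iff in Hx. destruct Hx as ([y|] & <- & Hy); auto.
Qed.

Lemma vover_const A y : incl y A -> vover A (map Some y).
Proof. intros H x Hx. apply in_map_iff in Hx. destruct Hx as (x' & [= ->] & Hx). auto. Qed.

Lemma vover_app A z z' : vover A z -> vover A z' -> vover A (z ++ z').
Proof. intros H H' x Hx. apply in_app_or in Hx. destruct Hx; auto. Qed.

(** The colours are taken from a palette [L] in an arbitrary type, so that a whole list of colours
    can serve as a single colour in the product arguments below. *)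
Definition HJ_for (A : list nat) (r N : nat) : Prop :=
  forall (K : Type) (L : list K) (k : list nat -> K), length L <= r ->
  (forall y, incl y A -> length y = N -> In (k y) L) ->
  exists z, length z = N /\ In None z /\ vover A z /\
    exists c, forall n, In n A -> k (subst n z) = c.

Definition focused (a : nat) (A : list nat) (N : nat) (K : Type) (k : list nat -> K)
  (f : list nat) (zc : list (option nat) * K) : Prop :=
  length (fst zc) = N /\ In None (fst zc) /\ vover (a :: A) (fst zc) /\
  subst a (fst zc) = f /\ forall n, In n A -> k (subst n (fst zc)) = snd zc.

(* Colour focusing: [s] lines through a common point, pairwise differently coloured off that point. *)
Definition focus_for (a : nat) (A : list nat) (r s N : nat) : Prop :=
  forall (K : Type) (L : list K) (k : list nat -> K), length L <= r ->
  (forall y, incl y (a :: A) -> length y = N -> In (k y) L) ->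
  (exists z, length z = N /\ In None z /\ vover (a :: A) z /\
    exists c, forall n, In n (a :: A) -> k (subst n z) = c) \/
  exists zs f, length zs = s /\ length f = N /\ incl f (a :: A) /\
    Forall (focused a A N K k f) zs /\ NoDup (map snd zs) /\ incl (map snd zs) L.

(** A line [z] in [N'] new coordinates is found on which the colouring of the remaining [N]
    coordinates does not depend on the letter of [b :: A]. The [s] focused lines of the remaining
    coordinates are prolonged by [z], and [z] followed by their focus is one more line. *)
Lemma focus_step a b A r s N :
  (forall r', exists N', HJ_for (b :: A) r' N') ->
  focus_for a (b :: A) r s N -> exists N', focus_for a (b :: A) r (S s) N'.
Proof.
  intros HJ HF. set (W := words (a :: b :: A) N).
  destruct (HJ (r ^ length W)) as [N' HN']. exists (N' + N).
  intros K L k HL Hk.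
  (* A word [y] is coloured by the vector of the colours of all [y ++ t]. *)
  destruct (HN' (list K) (words L (length W)) (fun y => map (fun t => k (y ++ t)) W))
    as (z & Lz & Nz & Vz & c & Hc).
  - rewrite length_words. apply Nat.pow_le_mono_l. exact HL.
  - intros y Hy Ly. apply in_words. rewrite length_map. split; [reflexivity|].
    intros x Hx. apply in_map_iff in Hx. destruct Hx as (t & <- & Ht). apply in_words in Ht.
    destruct Ht as [Lt It]. apply Hk; [|rewrite length_app; lia].
    apply incl_app; [|exact It]. intros x Hx. right. auto.
  - assert (Vz' : vover (a :: b :: A) z) by (intros x Hx; right; auto).
    (* The letter [b] stands for all letters of [b :: A]. *)
    set (k' := fun t => k (subst b z ++ t)).
    assert (Hk' : forall n t, In n (b :: A) -> length t = N -> incl t (a :: b :: A) ->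
              k (subst n z ++ t) = k' t).
    { intros n t Hn Lt It. pose proof (Hc n Hn) as E1. pose proof (Hc b (or_introl eq_refl)) as E2.
      rewrite <- E2 in E1. cbv beta in E1.
      apply (proj1 map_ext_in_iff E1 t). apply in_words. auto. }
    destruct (HF K L k' HL) as [(z' & Lz' & Nz' & Vz2 & c' & Hc')|(zs & f & Ls & Lf & If & Fo & Nd & Ii)].
    + intros y Iy Ly. apply Hk; [|rewrite length_app, length_subst; lia].
      apply incl_app; [|exact Iy]. apply subst_over; [exact Vz'|]. right. left. reflexivity.
    + left. exists (map Some (subst b z) ++ z'). split; [rewrite length_app, length_map, length_subst; lia|].
      split; [apply in_or_app; auto|]. split.
      * apply vover_app; [|exact Vz2]. apply vover_const, subst_over; [exact Vz'|]. right. left. reflexivity.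
      * exists c'. intros n Hn. rewrite subst_app, subst_const. apply Hc'. exact Hn.
    (* If the focus has the colour of one of the lines, that line is monochromatic for the letter
       [a] as well. *)
    + destruct (classic (In (k' f) (map snd zs))) as [Hin|Hin].
      * left. apply in_map_iff in Hin. destruct Hin as ([z1 c1] & E1 & H1). simpl in E1. subst c1.
        rewrite Forall_forall in Fo. destruct (Fo _ H1) as (L1 & N1 & V1 & S1 & C1). simpl in *.
        exists (map Some (subst b z) ++ z1). split; [rewrite length_app, length_map, length_subst; lia|].
        split; [apply in_or_app; auto|]. split.
        -- apply vover_app; [|exact V1]. apply vover_const, subst_over; [exact Vz'|]. right. left. reflexivity.
        -- exists (k' f). intros n Hn. rewrite subst_app, subst_const.
           change (k' (subst n z1) = k' f). destruct Hn as [<-|Hn]; [congruence|]. auto.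
      * right.
        (* The old lines vary in both blocks, the new one only in [z]; for the letter [a] all meet
           at [subst a z ++ f]. *)
        exists ((z ++ map Some f, k' f) :: map (fun zc => (z ++ fst zc, snd zc)) zs), (subst a z ++ f).
        split; [simpl; rewrite length_map; lia|].
        split; [rewrite length_app, length_subst; lia|].
        split; [apply incl_app; [apply subst_over; [exact Vz'|left; reflexivity]|exact If]|].
        split; [|split].
        -- constructor.
           ++ unfold focused; simpl. split; [rewrite length_app, length_map; lia|].
              split; [apply in_or_app; auto|].
              split; [apply vover_app; [exact Vz'|apply vover_const; exact If]|].
              split; [rewrite subst_app, subst_const; reflexivity|].
              intros n Hn. rewrite subst_app, subst_const. apply Hk'; auto.
           ++ apply Forall_map. rewrite Forall_forall in Fo |- *. intros [z1 c1] H1.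
              destruct (Fo _ H1) as (L1 & N1 & V1 & S1 & C1). unfold focused; simpl in *.
              split; [rewrite length_app; lia|]. split; [apply in_or_app; auto|].
              split; [apply vover_app; auto|]. split; [rewrite subst_app; congruence|].
              intros n Hn. rewrite subst_app, Hk'; auto.
              ** rewrite length_subst. exact L1.
              ** apply subst_over; [exact V1|]. right. exact Hn.
        -- simpl. rewrite map_map. simpl. constructor; auto.
        -- simpl. rewrite map_map. simpl. apply incl_cons; [|exact Ii].
           apply Hk; [|rewrite length_app, length_subst; lia].
           apply incl_app; [|exact If]. apply subst_over; [exact Vz'|]. right. left. reflexivity.
Qed.

(** Induction on the alphabet by colour focusing: [r + 1] focused lines would need [r + 1] colours,
    so among [r] colours a monochromatic line must appear. *)
Theorem hales_jewett (A : list nat) : A <> [] -> forall r, exists N, HJ_for A r N.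
Proof.
  induction A as [|a A IH]; [congruence|]. intros _ r.
  destruct A as [|b A].
  - exists 1. intros K L k _ _. exists [None]. split; [reflexivity|]. split; [left; reflexivity|].
    split; [intros x [H|[]]; discriminate|]. exists (k [a]). intros n [<-|[]]. reflexivity.
  - assert (Hf : forall s, exists N, focus_for a (b :: A) r s N).
    { induction s as [|s [N HN]].
      - exists 0. intros K L k _ _. right. exists [], []. simpl.
        repeat split; auto using NoDup_nil, incl_nil_l.
      - apply (focus_step a b A r s N); [|exact HN]. apply IH. discriminate. }
    destruct (Hf (S r)) as [N HN]. exists N. intros K L k HL Hk.
    destruct (HN K L k HL Hk) as [H|(zs & f & Ls & _ & _ & _ & Nd & Ii)]; [exact H|].
    pose proof (NoDup_incl_length Nd Ii) as h. rewrite length_map in h. lia.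
Qed.

Lemma first_variable (z : list (option nat)) : In None z -> exists p q, z = map Some p ++ None :: q.
Proof.
  induction z as [|[x|] z IH]; intros H; [destruct H| |].
  - destruct IH as (p & q & ->); [destruct H; [discriminate|auto]|]. exists (x :: p), q. reflexivity.
  - exists [], z. reflexivity.
Qed.

(** The form used later, where the constant prefix [w] shares the colour of the line. Induction on
    the number of colours: Hales-Jewett gives a line [z] such that the colours of all [z(n) ++ t]
    with [t] short are independent of [n]. Let [p] be the part of [z] before its first variable.
    Either some [z ++ t] has the colour of [p], or that colour is lost behind [z] and one colour
    fewer remains. *)
Lemma line_with_prefix (A : list nat) : A <> [] -> forall r, exists N,
  forall (K : Type) (L : list K) (k : list nat -> K), length L <= r ->
  (forall y, incl y A -> length y <= N -> In (k y) L) ->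
  exists w z, incl w A /\ vover A z /\ forall n, In n A -> k (w ++ n :: subst n z) = k w.
Proof.
  intros HA. destruct A as [|b A]; [congruence|]. set (B := b :: A) in *.
  assert (Hb : In b B) by (left; reflexivity).
  induction r as [|r [N IH]].
  - exists 0. intros K L k HL Hk. exfalso. specialize (Hk [] (incl_nil_l _) (le_n _)).
    destruct L; [destruct Hk|simpl in HL; lia].
  (* All lengths up to [N] are needed, since the induction hypothesis looks at words of every such
     length. *)
  - set (W := flat_map (words B) (seq 0 (S N))).
    assert (HW : forall t, In t W <-> incl t B /\ length t <= N).
    { intros t. unfold W. rewrite in_flat_map. split.
      - intros (n & Hn & Ht). apply in_words in Ht. apply in_seq in Hn. split; [apply Ht|lia].
      - intros [It Lt]. exists (length t). split; [apply in_seq; lia|]. apply in_words. auto. }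
    destruct (hales_jewett B HA (S r ^ length W)) as [N' HN']. exists (N' + N).
    intros K L k HL Hk.
    destruct (HN' (list K) (words L (length W)) (fun y => map (fun t => k (y ++ t)) W))
      as (z & Lz & Nz & Vz & c & Hc).
    + rewrite length_words. apply Nat.pow_le_mono_l. exact HL.
    + intros y Hy Ly. apply in_words. rewrite length_map. split; [reflexivity|].
      intros x Hx. apply in_map_iff in Hx. destruct Hx as (t & <- & Ht). apply HW in Ht.
      destruct Ht as [It Lt]. apply Hk; [apply incl_app; auto|rewrite length_app; lia].
    + assert (Hk' : forall n t, In n B -> In t W -> k (subst n z ++ t) = k (subst b z ++ t)).
      { intros n t Hn Ht. pose proof (Hc n Hn) as E1. rewrite <- (Hc b Hb) in E1.
        cbv beta in E1.
        apply (proj1 map_ext_in_iff E1 t). exact Ht. }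
      destruct (first_variable z Nz) as (p & q & Ez).
      assert (Ip : incl p B).
      { intros x Hx. apply Vz. rewrite Ez. apply in_or_app. left. apply in_map. exact Hx. }
      assert (Vq : vover B q).
      { intros x Hx. apply Vz. rewrite Ez. apply in_or_app. right. right. exact Hx. }
      assert (Lp : length p <= N').
      { rewrite <- Lz, Ez, length_app, length_map. lia. }
      destruct (classic (exists t, In t W /\ k (subst b z ++ t) = k p)) as [(t & Ht & Et)|Hno].
      * exists p, (q ++ map Some t). split; [exact Ip|]. split.
        -- apply vover_app; [exact Vq|]. apply vover_const. apply HW. exact Ht.
        -- intros n Hn. rewrite subst_app, subst_const.
           replace (p ++ n :: subst n q ++ t) with (subst n z ++ t).
           ++ rewrite Hk'; auto.
           ++ rewrite Ez, subst_app, subst_const. simpl. rewrite <- app_assoc. reflexivity.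
      * assert (Hin : In (k p) L) by (apply Hk; [exact Ip|lia]).
        destruct (in_split _ _ Hin) as (l1 & l2 & EL).
        destruct (IH K (l1 ++ l2) (fun t => k (subst b z ++ t))) as (w & z' & Iw & Vz' & Hw).
        -- rewrite EL in HL. rewrite length_app in *. simpl in HL. lia.
        -- intros y Iy Ly. assert (Hy : In (k (subst b z ++ y)) L).
           { apply Hk; [apply incl_app; [apply subst_over; auto|exact Iy]|].
             rewrite length_app, length_subst. lia. }
           rewrite EL in Hy. apply in_app_or in Hy. apply in_or_app.
           destruct Hy as [Hy|[Hy|Hy]]; auto. exfalso. apply Hno.
           exists y. split; [apply HW; auto|congruence].
        -- exists (subst b z ++ w), z'. split; [apply incl_app; [apply subst_over; auto|exact Iw]|].
           split; [exact Vz'|]. intros n Hn. rewrite <- app_assoc. apply Hw. exact Hn.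
Qed.

(** * Trees with a successor operation *)

Definition shift {A : Type} (j : nat) (f : nat -> A) : nat -> A := fun i => f (j + i).

Lemma shift_shift {A : Type} a b (f : nat -> A) : shift a (shift b f) = shift (b + a) f.
Proof. apply functional_extensionality. intros i. unfold shift. f_equal. lia. Qed.

Section Tree.
Context {D : Sdata} {M : (node D -> node D) -> Prop} (HSM : is_SMtree M).

Lemma tle_refl (a : node D) : tle a a.
Proof. apply HSM. Qed.

Lemma tle_antisym (a b : node D) : tle a b -> tle b a -> a = b.
Proof. apply HSM. Qed.

Lemma tle_trans (a b c : node D) : tle a b -> tle b c -> tle a c.
Proof. apply HSM. Qed.

Lemma predecessors (a : node D) : exists l, NoDup l /\ length l = lev a /\
  (forall b, In b l <-> strict b a).
Proof. apply HSM. Qed.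

Lemma tle_total_below (a b c : node D) : tle b a -> tle c a -> tle b c \/ tle c b.
Proof.
  intros Hb Hc.
  destruct (classic (b = a)) as [->|nb]; [auto|].
  destruct (classic (c = a)) as [->|nc]; [auto|].
  destruct HSM as [[(_ & _ & _ & _ & H) _] _]. apply (H a); split; auto.
Qed.

Lemma strict_lev (a b : node D) : strict b a -> lev b < lev a.
Proof.
  intros H.
  destruct (predecessors a) as (la & Na & La & Ha).
  destruct (predecessors b) as (lb & Nb & Lb & Hb).
  assert (Hn : NoDup (b :: lb)).
  { constructor; auto. rewrite Hb. intros [_ h]. auto. }
  assert (Hi : incl (b :: lb) la).
  { intros x [<-|Hx]; apply Ha; auto. apply Hb in Hx. destruct H as [H1 H2], Hx as [H3 H4].
    split. eapply tle_trans; eauto. intros ->. apply H2. apply tle_antisym; auto. }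
  pose proof (NoDup_incl_length Hn Hi) as h. simpl in h. lia.
Qed.

Lemma tle_lev (a b : node D) : tle a b -> lev a <= lev b.
Proof.
  intros H. destruct (classic (a = b)) as [->|n]; [lia|].
  assert (lev a < lev b) by (apply strict_lev; split; auto). lia.
Qed.

Lemma tle_lev_eq (a b : node D) : tle a b -> lev b <= lev a -> a = b.
Proof.
  intros H L. apply NNPP. intros n.
  assert (lev a < lev b) by (apply strict_lev; split; auto). lia.
Qed.

Lemma tle_below_lev (a b c : node D) : tle a c -> tle b c -> lev a <= lev b -> tle a b.
Proof.
  intros Ha Hb L. destruct (tle_total_below c a b Ha Hb) as [h|h]; [auto|].
  rewrite (tle_lev_eq b a h L). apply tle_refl.
Qed.

Lemma tle_below_eq (a b c : node D) : tle a c -> tle b c -> lev a = lev b -> a = b.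
Proof. intros Ha Hb L. apply tle_lev_eq; [|lia]. apply (tle_below_lev a b c); auto; lia. Qed.

(** The levels of the [lev a] predecessors of [a] are distinct numbers below [lev a], so by counting
    they are all of them. *)
Lemma ancestor (a : node D) n : n <= lev a -> exists b, tle b a /\ lev b = n.
Proof.
  intros L. destruct (Nat.eq_dec n (lev a)) as [->|ne].
  { exists a. split; [apply tle_refl | reflexivity]. }
  destruct (predecessors a) as (la & Na & La & Ha).
  assert (Hn : NoDup (map (@lev D) la)).
  { apply NoDup_map_NoDup_ForallPairs; [|exact Na].
    intros x y Hx Hy E. apply Ha in Hx, Hy. destruct Hx, Hy. eapply tle_below_eq; eauto. }
  assert (Hi : incl (map (@lev D) la) (seq 0 (lev a))).
  { intros x Hx. apply in_map_iff in Hx. destruct Hx as (y & <- & Hy).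
    apply Ha, strict_lev in Hy. apply in_seq. lia. }
  assert (Hr : incl (seq 0 (lev a)) (map (@lev D) la)).
  { apply NoDup_length_incl; auto. rewrite length_map, length_seq. lia. }
  assert (Hin : In n (map (@lev D) la)) by (apply Hr, in_seq; lia).
  apply in_map_iff in Hin. destruct Hin as (y & E & Hy). apply Ha in Hy.
  exists y. split; [apply Hy | exact E].
Qed.

Lemma imm_succ_iff (a b : node D) : imm_succ a b <-> tle a b /\ lev b = S (lev a).
Proof.
  split.
  - intros [Hs Hn]. split; [apply Hs|].
    pose proof (strict_lev _ _ Hs) as L.
    destruct (le_lt_dec (lev b) (S (lev a))) as [h|h]; [lia|].
    exfalso. apply Hn. destruct (ancestor b (S (lev a))) as (c & Hc & Lc); [lia|].
    exists c. split; split; auto.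
    + apply (tle_below_lev a c b); auto. apply Hs. lia.
    + intros ->. lia.
    + intros ->. lia.
  - intros [H L]. split.
    + split; auto. intros ->. lia.
    + intros (c & H1 & H2). apply strict_lev in H1, H2. lia.
Qed.

Lemma Sf_lev (a b : node D) p s : Sf a p s = Some b -> lev b = S (lev a).
Proof.
  intros H. destruct HSM as [(_ & _ & _ & _ & h & _) _].
  apply h in H. destruct H as [H _]. apply imm_succ_iff in H. apply H.
Qed.

Lemma Sf_tle (a b : node D) p s : Sf a p s = Some b -> tle a b.
Proof.
  intros H. destruct HSM as [(_ & _ & _ & _ & h & _) _].
  apply h in H. destruct H as [H _]. apply imm_succ_iff in H. apply H.
Qed.

Lemma Sf_args (a b : node D) p s q : Sf a p s = Some b -> In q p -> lev q < lev a.
Proof.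
  intros H Hq. destruct HSM as [(_ & _ & _ & _ & h & _) _].
  apply h in H. destruct H as [_ H]. specialize (H q Hq). lia.
Qed.

Lemma Sf_inj (a a' b : node D) p p' s s' :
  Sf a p s = Some b -> Sf a' p' s' = Some b -> a = a' /\ p = p' /\ s = s'.
Proof. intros H H'. destruct HSM as [(_ & _ & _ & _ & _ & h & _) _]. eapply h; eauto. Qed.

Lemma Sf_ex (a b : node D) : tle a b -> lev b = S (lev a) -> exists p s, Sf a p s = Some b.
Proof.
  intros H L. destruct HSM as [(_ & _ & _ & _ & _ & _ & h) _].
  apply h. apply imm_succ_iff. auto.
Qed.

Lemma level_finite n : exists l : list (node D), forall a, lev a = n -> In a l.
Proof.
  induction n as [|n [l IH]].
  - destruct HSM as [(_ & _ & _ & h & _) _]. exact h.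
  - assert (Hs : forall l' : list (node D), exists l2, forall a b, In a l' ->
               tle a b -> lev b = S (lev a) -> In b l2).
    { induction l' as [|x l' [l2 IH2]].
      - exists []. intros a b [].
      - destruct HSM as [(_ & _ & h & _) _]. destruct (h x) as [lx Hx].
        exists (lx ++ l2). intros a b [<-|Ha] H L; apply in_or_app.
        + left. apply Hx. apply imm_succ_iff. auto.
        + right. eapply IH2; eauto. }
    destruct (Hs l) as [l2 H2]. exists l2. intros b L.
    destruct (ancestor b n) as (a & Ha & La); [lia|].
    apply (H2 a b); auto. lia.
Qed.

(** * Order and levels under a single member of M *)

Section OneMap.
Variable F : node D -> node D.
Hypothesis MF : M F.

Lemma M_inj a b : F a = F b -> a = b.
Proof. destruct HSM as (_ & h & _). apply h; auto. Qed.

Lemma M_level a b : lev a = lev b -> lev (F a) = lev (F b).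
Proof. destruct HSM as (_ & h & _). apply h; auto. Qed.

Lemma M_Sf a b p s : Sf a p s = Some b ->
  exists b', Sf (F a) (map F p) s = Some b' /\ tle b' (F b).
Proof. destruct HSM as (_ & h & _). apply h; auto. Qed.

(** Shape preservation controls one successor step at a time; the steps between [a] and [b] are
    chained. *)
Lemma M_mono a b : tle a b -> tle (F a) (F b).
Proof.
  remember (lev b - lev a) as n eqn:En. revert b En.
  induction n as [|n IH]; intros b En H.
  - rewrite (tle_lev_eq a b H); [apply tle_refl | lia].
  - destruct (ancestor b (pred (lev b))) as (c & Hc & Lc); [lia|].
    assert (Hac : tle a c) by (apply (tle_below_lev a c b); auto; lia).
    apply tle_trans with (F c); [apply IH; [lia|exact Hac]|].
    destruct (Sf_ex c b Hc) as (p & s & E); [lia|].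
    destruct (M_Sf _ _ _ _ E) as (b' & E' & Hb').
    eapply tle_trans; [eapply Sf_tle; eauto | exact Hb'].
Qed.

Lemma M_lev_succ a b : lev b = S (lev a) -> S (lev (F a)) <= lev (F b).
Proof.
  intros L. destruct (ancestor b (lev a)) as (c & Hc & Lc); [lia|].
  rewrite (M_level a c) by lia.
  destruct (Sf_ex c b Hc) as (p & s & E); [lia|].
  destruct (M_Sf _ _ _ _ E) as (b' & E' & Hb').
  apply Sf_lev in E'. apply tle_lev in Hb'. lia.
Qed.

Lemma M_lev_mono a b : lev a <= lev b -> lev (F a) + (lev b - lev a) <= lev (F b).
Proof.
  remember (lev b - lev a) as n eqn:En. revert b En.
  induction n as [|n IH]; intros b En L.
  - rewrite (M_level a b); lia.
  - destruct (ancestor b (pred (lev b))) as (c & Hc & Lc); [lia|].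
    pose proof (IH c ltac:(lia) ltac:(lia)). pose proof (M_lev_succ c b ltac:(lia)). lia.
Qed.

Lemma M_lev_ge a : lev a <= lev (F a).
Proof.
  destruct (ancestor a 0) as (c & Hc & Lc); [lia|].
  pose proof (M_lev_mono c a). lia.
Qed.

Lemma map_id_below k p : (forall a, lev a < k -> F a = a) ->
  (forall q, In q p -> lev q < k) -> map F p = p.
Proof.
  intros Hid Hp. rewrite <- map_id. apply map_ext_in. intros q Hq. apply Hid. auto.
Qed.

(** If [a] is the successor of [c] with label [(p, s)], then [c] and the entries of [p] lie below
    level [k] and are fixed, so shape preservation puts this same successor below [F a]. For roots
    this is condition (iii). *)
Lemma M_tle k a : (forall b, lev b < k -> F b = b) -> lev a <= k -> tle a (F a).
Proof.
  intros Hid L. destruct (lev a) as [|n] eqn:Ea.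
  - destruct HSM as (_ & h & _). apply (h F MF); auto using tle_refl.
  - destruct (ancestor a n) as (c & Hc & Lc); [lia|].
    destruct (Sf_ex c a Hc) as (p & s & E); [lia|].
    destruct (M_Sf _ _ _ _ E) as (b' & E' & Hb').
    rewrite (Hid c) in E' by lia.
    rewrite (map_id_below k) in E'; [congruence|exact Hid|].
    intros q Hq. pose proof (Sf_args _ _ _ _ _ E Hq). lia.
Qed.
End OneMap.

(** * Morphisms between levels, their factorisations and canonical extensions *)

Lemma M_id : M (fun a => a).
Proof. apply HSM. Qed.

Lemma M_comp F G : M F -> M G -> M (fun a => F (G a)).
Proof. apply HSM. Qed.

Lemma level_nonempty n : exists a : node D, lev a = n.
Proof.
  destruct HSM as (_ & _ & _ & _ & _ & _ & h).
  destruct (h n (S n)) as (F & _ & Hs & _); [lia|].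
  destruct (proj2 (Hs n)) as [a Ha]; [lia|]. eauto.
Qed.

(* [F] belongs to M^k and sends level [k] to level [m]; only F|T(<= k) matters, so that
   [Hom k m] is AM^k_1(m), a category under composition. *)
Definition Hom (k m : nat) (F : node D -> node D) : Prop :=
  M F /\ (forall a, lev a < k -> F a = a) /\ (forall a, lev a = k -> lev (F a) = m).

(** The level map is strictly increasing, so its range determines it: levels below [m] are kept and
    [m] goes to [m + 1]. A node whose level is kept is fixed, by induction and [M_tle]. *)
Lemma skips_only_Hom F m : M F -> skips_only F m -> Hom m (S m) F.
Proof.
  intros MF Hs.
  assert (Hid : forall l a, l < m -> lev a = l -> F a = a).
  { induction l as [l IH] using lt_wf_ind. intros a Hl La.
    symmetry. apply tle_lev_eq.
    - apply (M_tle F MF l); [|lia]. intros b Lb. apply (IH (lev b)); lia.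
    - destruct (proj2 (Hs l)) as [b Hb]; [lia|].
      destruct (lt_eq_lt_dec (lev b) l) as [[h|h]|h].
      + rewrite (IH (lev b)) in Hb; lia.
      + rewrite (M_level F MF a b); lia.
      + pose proof (M_lev_ge F MF b). lia. }
  split; [exact MF|]. split.
  - intros a La. apply (Hid (lev a)); auto.
  - intros a La. pose proof (M_lev_ge F MF a).
    assert (lev (F a) <> m) by (apply Hs; eauto).
    destruct (proj2 (Hs (S m))) as [b Hb]; [lia|].
    destruct (lt_eq_lt_dec (lev b) m) as [[h|h]|h].
    + rewrite (Hid (lev b)) in Hb; lia.
    + rewrite (M_level F MF a b); lia.
    + pose proof (M_lev_mono F MF a b). lia.
Qed.

Lemma Hom_le k m F : Hom k m F -> k <= m.
Proof.
  intros (MF & _ & HL). destruct (level_nonempty k) as [a La].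
  rewrite <- (HL a La), <- La. apply M_lev_ge; auto.
Qed.

Lemma Hom_id k : Hom k k (fun a => a).
Proof. split; [apply M_id|]. split; auto. Qed.

Lemma Hom_comp k m m' F G : Hom k m F -> Hom m m' G -> Hom k m' (fun a => G (F a)).
Proof.
  intros HF HG. pose proof (Hom_le _ _ _ HF) as L.
  destruct HF as (MF & IF & LF), HG as (MG & IG & LG).
  split; [apply (M_comp G F); auto|]. split.
  - intros a La. rewrite IF by auto. apply IG. lia.
  - intros a La. auto.
Qed.

Lemma Hom_tle k m F a : Hom k m F -> lev a <= k -> tle a (F a).
Proof. intros (MF & IF & _) L. apply (M_tle F MF k); auto. Qed.

Lemma Hom_Sf k m F a b p s : Hom k m F -> lev a <= k -> Sf a p s = Some b ->
  exists b', Sf (F a) p s = Some b' /\ tle b' (F b).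
Proof.
  intros (MF & IF & _) L E. destruct (M_Sf F MF _ _ _ _ E) as (b' & E' & H).
  rewrite (map_id_below F k) in E'; eauto.
  intros q Hq. pose proof (Sf_args _ _ _ _ _ E Hq). lia.
Qed.

(** (M2) applies because [F] is the identity below [k] and starts from [S m] at level [k], so it
    skips [m]. Injectivity of [F2] then makes [F1] the identity below [k]. *)
Lemma Hom_factor_one k m F : Hom k (S m) F -> k <= m ->
  exists F1 F2, Hom k m F1 /\ Hom m (S m) F2 /\ forall a, lev a <= k -> F2 (F1 a) = F a.
Proof.
  intros (MF & IF & LF) Hkm. destruct (level_nonempty k) as [a La].
  destruct HSM as (_ & _ & _ & _ & _ & h & _).
  destruct (h k F a MF La) as (F1 & F2 & M1 & M2 & Hs & E).
  - rewrite (LF a La). lia.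
  - rewrite (LF a La). intros (b & Hb).
    destruct (lt_eq_lt_dec (lev b) k) as [[L|L]|L].
    + rewrite IF in Hb; lia.
    + rewrite LF in Hb; lia.
    + pose proof (M_lev_mono F MF a b). rewrite (LF a La) in *. lia.
  - rewrite (LF a La) in Hs. replace (S m - 1) with m in Hs by lia.
    pose proof (skips_only_Hom F2 m M2 Hs) as H2.
    destruct H2 as (_ & I2 & L2).
    assert (I1 : forall b, lev b < k -> F1 b = b).
    { intros b Lb. apply (M_inj F2 M2). rewrite E, IF by lia. symmetry. apply I2. lia. }
    exists F1, F2. split; [split; [exact M1|split; [exact I1|]]|split; [split; auto|exact E]].
    intros b Lb. assert (Eb := E b ltac:(lia)).
    assert (LFb := LF b Lb). rewrite <- Eb in LFb.
    destruct (lt_eq_lt_dec (lev (F1 b)) m) as [[h1|h1]|h1]; [|exact h1|].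
    + rewrite I2 in LFb; lia.
    + destruct (level_nonempty m) as [x Lx].
      pose proof (M_lev_mono F2 M2 x (F1 b)). rewrite (L2 x Lx) in *. lia.
Qed.

Lemma Hom_factor k l m F : Hom k m F -> k <= l -> l <= m ->
  exists F1 F2, Hom k l F1 /\ Hom l m F2 /\ forall a, lev a <= k -> F2 (F1 a) = F a.
Proof.
  intros HF Hkl Hlm. remember (m - l) as n eqn:En. revert m F HF Hlm En.
  induction n as [|n IH]; intros m F HF Hlm En.
  - replace l with m by lia. exists F, (fun a => a). split; [exact HF|]. split; [apply Hom_id|auto].
  - destruct m as [|m]; [lia|].
    destruct (Hom_factor_one k m F HF) as (F1 & F2 & H1 & H2 & E); [lia|].
    destruct (IH m F1 H1) as (G1 & G2 & H3 & H4 & E'); [lia|lia|].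
    exists G1, (fun a => F2 (G2 a)). split; [exact H3|]. split; [eapply Hom_comp; eauto|].
    intros a La. rewrite E', E; auto.
Qed.

Lemma Hom_lev_le k m F a : Hom k m F -> lev a <= k -> lev (F a) <= m.
Proof.
  intros HF L. pose proof (Hom_le _ _ _ HF). destruct HF as (_ & I & E).
  destruct (Nat.eq_dec (lev a) k) as [e|ne]; [rewrite E; auto|rewrite I; lia].
Qed.

(** As long as level [n + 1] is sent above [m + 1], the level just under its image is skipped. Then
    [F1] of (M2) sends level [n + 1] one level lower and agrees with [F] on T(<= n), where [F2] acts
    on the image as the identity. Induction on the size of the gap. *)
Lemma tighten_next n m F : M F -> (forall a, lev a = n -> lev (F a) = m) ->
  exists G, M G /\ (forall a, lev a <= n -> G a = F a) /\
    (forall a, lev a = S n -> lev (G a) = S m).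
Proof.
  intros MF LF. destruct (level_nonempty (S n)) as [a La].
  destruct (level_nonempty n) as [a0 La0].
  remember (lev (F a) - S m) as d eqn:Ed. revert F MF LF Ed.
  induction d as [|d IH]; intros F MF LF Ed.
  - exists F. split; [exact MF|]. split; [auto|]. intros b Lb.
    rewrite (M_level F MF b a) by lia. pose proof (M_lev_succ F MF a0 a ltac:(lia)).
    rewrite (LF a0 La0) in *. lia.
  - destruct HSM as (_ & _ & _ & _ & _ & h & _).
    destruct (h (S n) F a MF La) as (F1 & F2 & M1 & M2 & Hs & E); [lia| |].
    { intros (b & Hb). destruct (le_lt_dec (lev b) n) as [L|L].
      - pose proof (M_lev_mono F MF b a0). rewrite (LF a0 La0) in *. lia.
      - pose proof (M_lev_mono F MF a b). lia. }
    pose proof (skips_only_Hom F2 _ M2 Hs) as (_ & I2 & L2).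
    assert (E1 : forall b, lev b <= n -> F1 b = F b).
    { intros b Lb. apply (M_inj F2 M2). rewrite E by lia. symmetry. apply I2.
      pose proof (M_lev_mono F MF b a0). rewrite (LF a0 La0) in *. lia. }
    assert (L1 : lev (F1 a) = lev (F a) - 1).
    { assert (Ea := E a ltac:(lia)).
      destruct (lt_eq_lt_dec (lev (F1 a)) (lev (F a) - 1)) as [[h1|h1]|h1]; [|exact h1|].
      + rewrite I2 in Ea by lia. rewrite Ea in h1. lia.
      + destruct (level_nonempty (lev (F a) - 1)) as [x Lx].
        pose proof (M_lev_mono F2 M2 x (F1 a)). rewrite (L2 x Lx), Ea in *. lia. }
    destruct (IH F1 M1) as (G & MG & EG & LG).
    + intros b Lb. rewrite E1 by lia. auto.
    + lia.
    + exists G. split; [exact MG|]. split; [|exact LG].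
      intros b Lb. rewrite EG, E1; auto.
Qed.

(** Tightens one level after the other and takes the limit provided by (M1). *)
Lemma canonical_extension k m F : M F -> (forall a, lev a = k -> lev (F a) = m) ->
  exists G, M G /\ (forall a, lev a <= k -> G a = F a) /\
    (forall i a, lev a = k + i -> lev (G a) = m + i).
Proof.
  intros MF LF.
  destruct (dependent_choice (node D -> node D)
    (fun i G => M G /\ forall a, lev a = k + i -> lev (G a) = m + i)
    (fun i G G' => forall a, lev a <= k + i -> G' a = G a) F) as (Fs & F0 & HFs).
  - split; auto. intros a La. replace (m + 0) with m by lia. apply LF. lia.
  - intros i G (MG & LG). destruct (tighten_next (k + i) (m + i) G MG LG) as (G' & M' & E' & L').
    exists G'. split; [split; auto|auto]. intros a La. rewrite L'; lia.
  - assert (Hag : forall i j a, lev a <= k + i -> Fs (i + j) a = Fs i a).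
    { induction j as [|j IH]; intros a La; [f_equal; lia|].
      replace (i + S j) with (S (i + j)) by lia.
      rewrite (proj2 (HFs (i + j))) by lia. apply IH. auto. }
    destruct HSM as (_ & _ & _ & _ & h & _).
    destruct (h Fs) as (G & MG & EG).
    + intros i. apply HFs.
    + intros i a La. symmetry. apply (proj2 (HFs i)). lia.
    + assert (EG' : forall i a, lev a <= k + i -> G a = Fs i a).
      { intros i a La. rewrite (EG (k + i) a La).
        replace (k + i) with (i + k) by lia. apply Hag. auto. }
      exists G. split; [exact MG|]. split.
      * intros a La. rewrite (EG' 0) by lia. rewrite F0. auto.
      * intros i a La. rewrite (EG' i) by lia. apply (HFs i). auto.
Qed.

(* [sharp k m F]: the restriction to T(<= k+1) agrees with the canonical extension of F|T(<= k). *)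
Definition sharp (k m : nat) (F : node D -> node D) : Prop :=
  Hom k m F /\ forall a, lev a = S k -> lev (F a) = S m.

Lemma sharpen k m F : Hom k m F -> exists G, sharp k m G /\ forall a, lev a <= k -> G a = F a.
Proof.
  intros (MF & IF & LF). destruct (canonical_extension k m F MF LF) as (G & MG & EG & LG).
  exists G. split; [|exact EG]. split; [split; [exact MG|split]|].
  - intros a La. rewrite EG by lia. auto.
  - intros a La. rewrite EG by lia. auto.
  - intros a La. rewrite (LG 1); lia.
Qed.

(** Shape preservation gives only the relation [tle] between the two nodes; sharpness puts them on
    the same level. *)
Lemma sharp_Sf k m F a b p s : sharp k m F -> lev a = k -> Sf a p s = Some b ->
  Sf (F a) p s = Some (F b).
Proof.
  intros [HF HS] La E. destruct (Hom_Sf k m F a b p s HF) as (b' & E' & H); [lia|exact E|].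
  rewrite E'. f_equal. apply tle_lev_eq; [exact H|].
  rewrite (Sf_lev _ _ _ _ E'). pose proof (Sf_lev _ _ _ _ E).
  rewrite HS by lia. destruct HF as (_ & _ & L). rewrite L; lia.
Qed.

(* [lab b n p s]: the step of the branch of [b] out of level [n] is labelled [(p, s)]. *)
Definition lab (b : node D) (n : nat) (p : list (node D)) (s : sig D) : Prop :=
  exists a x, lev a = n /\ Sf a p s = Some x /\ tle x b.

Lemma lab_ex b n : n < lev b -> exists p s, lab b n p s.
Proof.
  intros L. destruct (ancestor b (S n)) as (x & Hx & Lx); [lia|].
  destruct (ancestor x n) as (a & Ha & La); [lia|].
  destruct (Sf_ex a x Ha) as (p & s & E); [lia|].
  exists p, s, a, x. auto.
Qed.

Lemma lab_unique b n p s p' s' : lab b n p s -> lab b n p' s' -> p = p' /\ s = s'.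
Proof.
  intros (a & x & La & E & H) (a' & x' & La' & E' & H').
  assert (x = x') as <-.
  { apply (tle_below_eq x x' b); auto.
    rewrite (Sf_lev _ _ _ _ E), (Sf_lev _ _ _ _ E'). lia. }
  destruct (Sf_inj _ _ _ _ _ _ _ E E') as (_ & -> & ->). auto.
Qed.

Lemma lab_tle b b' n p s : lab b n p s -> tle b b' -> lab b' n p s.
Proof. intros (a & x & La & E & H) H'. exists a, x. eauto using tle_trans. Qed.

Lemma lab_below b b' n p s : lab b' n p s -> tle b b' -> n < lev b -> lab b n p s.
Proof.
  intros H H' L. destruct (lab_ex b n L) as (p' & s' & H2).
  destruct (lab_unique b' n p s p' s' H (lab_tle _ _ _ _ _ H2 H')) as (-> & ->). exact H2.
Qed.

(** (M3) in terms of labels: at level [m] every branch repeats its own label from level [n]. *)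
Lemma copy_map n m : n < m -> exists F, Hom m (S m) F /\
  forall b p s, lev b = m -> lab b n p s -> Sf b p s = Some (F b).
Proof.
  intros L. destruct HSM as (_ & _ & _ & _ & _ & _ & h).
  destruct (h n m L) as (F & MF & Hs & HF). exists F. split; [apply skips_only_Hom; auto|].
  intros b p s Lb (a & x & La & E & H). eapply HF; eauto.
Qed.

(** * Paths and fusion *)

Definition restr (k : nat) (F : node D -> node D) : approx :=
  fun a => if lev a <=? k then Some (F a) else None.

Lemma restr_le k F a : lev a <= k -> restr k F a = Some (F a).
Proof. intros L. unfold restr. apply Nat.leb_le in L. rewrite L. reflexivity. Qed.

Lemma restr_ext k F G : (forall a, lev a <= k -> F a = G a) -> restr k F = restr k G.
Proof.
  intros H. apply functional_extensionality. intros a. unfold restr.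
  destruct (lev a <=? k) eqn:E; [|reflexivity]. apply Nat.leb_le in E. rewrite H; auto.
Qed.

Lemma restr_inj k F G a : restr k F = restr k G -> lev a <= k -> F a = G a.
Proof.
  intros H L. apply (f_equal (fun f => f a)) in H. rewrite !restr_le in H by exact L. congruence.
Qed.

(** The target [m] is the next cut, one above the level to which [u] sends level [k]; positivity
    keeps [m - 1] from being truncated. *)
Definition edge (k : nat) (u : approx) (m : nat) : Prop := 0 < m /\ in_AMn1 M k (m - 1) u.

Lemma edge_iff k u m : edge k u m <-> exists m' F, m = S m' /\ Hom k m' F /\ u = restr k F.
Proof.
  split.
  - intros (L & F & MF & IF & EF & LF). exists (m - 1), F. split; [lia|]. split; [split; auto|].
    apply functional_extensionality. exact EF.
  - intros (m' & F & -> & (MF & IF & LF) & ->). split; [lia|].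
    exists F. replace (S m' - 1) with m' by lia. split; [exact MF|]. split; [exact IF|].
    split; [reflexivity | exact LF].
Qed.

Lemma edge_restr k m F : Hom k m F -> edge k (restr k F) (S m).
Proof. intros H. apply edge_iff. eauto. Qed.

Lemma edge_lt k u m : edge k u m -> k < m.
Proof. intros H. apply edge_iff in H. destruct H as (m' & F & -> & H & _). apply Hom_le in H. lia. Qed.

Lemma edge_target k u m m' : edge k u m -> edge k u m' -> m = m'.
Proof.
  intros H H'. apply edge_iff in H, H'.
  destruct H as (n & F & -> & (_ & _ & L) & ->), H' as (n' & F' & -> & (_ & _ & L') & E).
  destruct (level_nonempty k) as [a La].
  rewrite <- (L a La), <- (L' a La). do 2 f_equal. apply (restr_inj k); auto. lia.
Qed.

(** For an edge [u] this is [y = u^+(x)] with [x] the immediate successor of [a] labelled [(p, s)]: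
    the canonical extension keeps labels, so it can be left unnamed. *)
Definition rel (u : approx) (a y : node D) : Prop :=
  exists p s x a', Sf a p s = Some x /\ u a = Some a' /\ Sf a' p s = Some y.

(* [comp U i d a] is Lift_U({a}, i, i + d) when [a] is on the level of the [i]-th cut. *)
Fixpoint comp (U : nat -> approx) (i d : nat) (a y : node D) : Prop :=
  match d with
  | 0 => a = y
  | S d' => exists b, rel (U i) a b /\ comp U (S i) d' b y
  end.

Definition path (U : nat -> approx) (c : nat -> nat) : Prop :=
  forall i, edge (c i) (U i) (c (S i)).

Definition sub_edge (k : nat) (v : approx) (U : nat -> approx) (i d : nat) : Prop :=
  forall a y, lev a = k -> rel v a y -> comp U i d a y.

(* The order on fat subtrees, with explicit cut functions. Paths may start at any level:
   the tail of a fat subtree above a cut is again a path. *)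
Definition refines (V : nat -> approx) (cV : nat -> nat) (U : nat -> approx) (cU : nat -> nat) : Prop :=
  forall l, exists i d, cV l = cU i /\ cV (S l) = cU (i + d) /\ sub_edge (cV l) (V l) U i d.

Lemma rel_lev k u m a y : edge k u m -> lev a = k -> rel u a y -> lev y = m /\ tle a y.
Proof.
  intros He La (p & s & x & a' & E1 & E2 & E3). apply edge_iff in He.
  destruct He as (m' & F & -> & HF & ->). rewrite restr_le in E2 by lia. injection E2 as <-.
  pose proof HF as (_ & _ & LF). rewrite (Sf_lev _ _ _ _ E3), LF by exact La.
  split; [reflexivity|]. eapply tle_trans; [|eapply Sf_tle; eauto].
  apply (Hom_tle k m'); [exact HF|lia].
Qed.

Lemma path_mono U c i j : path U c -> i <= j -> c i + (j - i) <= c j.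
Proof.
  intros HP L. induction L as [|j L IH]; [lia|].
  pose proof (edge_lt _ _ _ (HP j)). lia.
Qed.

Lemma path_inj U c i j : path U c -> c i = c j -> i = j.
Proof.
  intros HP E. destruct (lt_eq_lt_dec i j) as [[h|h]|h]; [|exact h|].
  - pose proof (path_mono U c i j HP ltac:(lia)). lia.
  - pose proof (path_mono U c j i HP ltac:(lia)). lia.
Qed.

Lemma path_le_inv U c i j : path U c -> c i <= c j -> i <= j.
Proof.
  intros HP E. destruct (le_lt_dec i j) as [h|h]; [exact h|].
  pose proof (path_mono U c j i HP ltac:(lia)). lia.
Qed.

Lemma path_shift U c j : path U c -> path (shift j U) (shift j c).
Proof. intros HP i. unfold shift. rewrite Nat.add_succ_r. apply HP. Qed.

Lemma comp_lev U c i d a y : path U c -> lev a = c i -> comp U i d a y ->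
  lev y = c (i + d) /\ tle a y.
Proof.
  intros HP. revert i a. induction d as [|d IH]; intros i a La H.
  - simpl in H. subst y. rewrite Nat.add_0_r. split; [exact La|apply tle_refl].
  - destruct H as (b & H1 & H2). destruct (rel_lev _ _ _ _ _ (HP i) La H1) as [Lb Hb].
    destruct (IH _ _ Lb H2) as [Ly Hy]. replace (i + S d) with (S i + d) by lia.
    split; [exact Ly|]. eapply tle_trans; eauto.
Qed.

Lemma comp_app U i d d' a b y : comp U i d a b -> comp U (i + d) d' b y -> comp U i (d + d') a y.
Proof.
  revert i a. induction d as [|d IH]; intros i a H H'; simpl in *.
  - subst b. rewrite Nat.add_0_r in H'. exact H'.
  - destruct H as (x & H1 & H2). exists x. split; [exact H1|].
    apply IH; [exact H2|]. replace (S i + d) with (i + S d) by lia. exact H'.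
Qed.

Lemma comp_split U i d d' a y : comp U i (d + d') a y ->
  exists b, comp U i d a b /\ comp U (i + d) d' b y.
Proof.
  revert i a. induction d as [|d IH]; intros i a H; simpl in *.
  - exists a. rewrite Nat.add_0_r. auto.
  - destruct H as (x & H1 & H2). destruct (IH _ _ H2) as (b & H3 & H4).
    exists b. split; [eauto|]. replace (i + S d) with (S i + d) by lia. exact H4.
Qed.

Lemma comp_one U i a y : comp U i 1 a y <-> rel (U i) a y.
Proof.
  simpl. split.
  - intros (b & H & <-). exact H.
  - intros H. exists y. auto.
Qed.

Lemma comp_snoc U i d a b y : comp U i d a b -> rel (U (i + d)) b y -> comp U i (S d) a y.
Proof.
  intros H H'. replace (S d) with (d + 1) by lia. eapply comp_app; [exact H|].
  apply comp_one. exact H'.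
Qed.

Lemma comp_snoc_inv U i d a y : comp U i (S d) a y -> exists b, comp U i d a b /\ rel (U (i + d)) b y.
Proof.
  replace (S d) with (d + 1) by lia. intros H. apply comp_split in H.
  destruct H as (b & H1 & H2). apply comp_one in H2. eauto.
Qed.

Lemma comp_shift U j i d a y : comp (shift j U) i d a y <-> comp U (j + i) d a y.
Proof.
  revert i a. induction d as [|d IH]; intros i a; simpl; [reflexivity|].
  split; intros (b & H1 & H2); exists b; (split; [exact H1|]).
  - apply IH in H2. rewrite Nat.add_succ_r in H2. exact H2.
  - apply IH. rewrite Nat.add_succ_r. exact H2.
Qed.

Lemma refines_refl U c : path U c -> refines U c U c.
Proof.
  intros HP l. exists l, 1. split; [reflexivity|]. split; [f_equal; lia|].
  intros a y La H. apply comp_one. exact H.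
Qed.

Lemma refines_cut V cV U cU l : refines V cV U cU -> exists i, cV l = cU i.
Proof. intros H. destruct (H l) as (i & d & E & _). eauto. Qed.

Lemma comp_refines V cV U cU i d : path V cV -> path U cU -> refines V cV U cU ->
  exists i' d', cV i = cU i' /\ cV (i + d) = cU (i' + d') /\
    forall a y, lev a = cV i -> comp V i d a y -> comp U i' d' a y.
Proof.
  intros HV HU HR. revert i. induction d as [|d IH]; intros i.
  - destruct (refines_cut _ _ _ _ i HR) as [i' E]. exists i', 0.
    rewrite !Nat.add_0_r. split; [exact E|]. split; [exact E|]. intros a y La H. exact H.
  - destruct (HR i) as (i' & d1 & E1 & E2 & HS).
    destruct (IH (S i)) as (j & d2 & E3 & E4 & HC).
    assert (j = i' + d1) as -> by (apply (path_inj U cU); [exact HU|congruence]).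
    exists i', (d1 + d2). split; [exact E1|]. split.
    + rewrite Nat.add_assoc, <- E4. f_equal. lia.
    + intros a y La (b & H1 & H2). destruct (rel_lev _ _ _ _ _ (HV i) La H1) as [Lb _].
      eapply comp_app; [apply HS; eauto|]. apply HC; auto.
Qed.

Lemma refines_trans V cV U cU W cW : path U cU -> path W cW ->
  refines V cV U cU -> refines U cU W cW -> refines V cV W cW.
Proof.
  intros HU HW H1 H2 l. destruct (H1 l) as (i & d & E1 & E2 & HS).
  destruct (comp_refines U cU W cW i d HU HW H2) as (i' & d' & E3 & E4 & HC).
  exists i', d'. split; [congruence|]. split; [congruence|].
  intros a y La H. apply HC; [congruence|]. apply HS; auto.
Qed.

Lemma refines_shift V cV U cU l i : path V cV -> path U cU -> refines V cV U cU -> cV l = cU i ->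
  refines (shift l V) (shift l cV) (shift i U) (shift i cU).
Proof.
  intros HV HU HR E n. destruct (HR (l + n)) as (j & d & E1 & E2 & HS).
  assert (L : i <= j).
  { apply (path_le_inv U cU); [exact HU|]. rewrite <- E, <- E1.
    pose proof (path_mono V cV l (l + n) HV ltac:(lia)). lia. }
  exists (j - i), d. unfold shift. rewrite Nat.add_succ_r.
  replace (i + (j - i)) with j by lia. replace (i + (j - i + d)) with (j + d) by lia.
  split; [exact E1|]. split; [exact E2|]. intros a y La H.
  apply (proj2 (comp_shift U i (j - i) d a y)). replace (i + (j - i)) with j by lia. apply HS; auto.
Qed.

(** The skeleton of all fusion arguments: [V n] is a first edge inside the [n]-th tree, and the next
    tree refines what remains of it. By induction on [l], the tree [Us (n + l)] refines a tail of
    [Us n], hence so do the edges taken from it. *)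
Lemma diagonal (Us : nat -> nat -> approx) (cs : nat -> nat -> nat) (js : nat -> nat) (V : nat -> approx) :
  (forall n, path (Us n) (cs n)) ->
  (forall n, edge (cs n 0) (V n) (cs n (js n))) ->
  (forall n, sub_edge (cs n 0) (V n) (Us n) 0 (js n)) ->
  (forall n, cs (S n) 0 = cs n (js n)) ->
  (forall n, refines (Us (S n)) (cs (S n)) (shift (js n) (Us n)) (shift (js n) (cs n))) ->
  path V (fun n => cs n 0) /\
  forall n, refines (shift n V) (shift n (fun n => cs n 0)) (Us n) (cs n).
Proof.
  intros HP HE HS Hc HR. split.
  { intros n. rewrite Hc. apply HE. }
  assert (Hk : forall n l, exists i, cs (n + l) 0 = cs n i /\
            refines (Us (n + l)) (cs (n + l)) (shift i (Us n)) (shift i (cs n))).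
  { intros n l. induction l as [|l (i & E & H)].
    - exists 0. rewrite Nat.add_0_r. split; [reflexivity|]. apply refines_refl. apply HP.
    - destruct (refines_cut _ _ _ _ (js (n + l)) H) as [i0 E0].
      exists (i + i0). rewrite Nat.add_succ_r. split; [rewrite Hc; exact E0|].
      rewrite <- !shift_shift. eapply refines_trans; [| |apply HR|].
      + apply path_shift, HP.
      + do 2 apply path_shift. apply HP.
      + apply refines_shift; auto. apply path_shift, HP. }
  intros n l. destruct (Hk n l) as (i & E & H).
  destruct (comp_refines _ _ _ _ 0 (js (n + l)) (HP (n + l)) (path_shift _ _ i (HP n)) H)
    as (i' & d' & E1 & E2 & HC).
  unfold shift in *. exists (i + i'), d'. rewrite Nat.add_succ_r, Hc.
  split; [exact E1|]. split; [rewrite <- Nat.add_assoc; exact E2|].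
  intros a y La Hr. apply (proj1 (comp_shift (Us n) i i' d' a y)). apply HC; [exact La|].
  apply HS; auto.
Qed.

(** * Finite paths, finiteness and fusion *)

Inductive fpath : nat -> list approx -> nat -> Prop :=
| fpath_nil k : fpath k [] k
| fpath_cons k e m y m' : edge k e m -> fpath m y m' -> fpath k (e :: y) m'.

Inductive fin_below (U : nat -> approx) (c : nat -> nat) : nat -> list approx -> nat -> Prop :=
| fb_nil i : fin_below U c i [] i
| fb_cons i d e y j : edge (c i) e (c (i + d)) -> sub_edge (c i) e U i d ->
    fin_below U c (i + d) y j -> fin_below U c i (e :: y) j.

Lemma fin_below_fpath U c i y j : fin_below U c i y j -> fpath (c i) y (c j).
Proof. induction 1; econstructor; eauto. Qed.

Lemma fpath_le k y m : fpath k y m -> k <= m.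
Proof. induction 1 as [|k e m y m' He H IH]; [lia|]. apply edge_lt in He. lia. Qed.

Lemma fpath_app k y m z m' : fpath k y m -> fpath m z m' -> fpath k (y ++ z) m'.
Proof. induction 1; intros H'; simpl; [exact H'|]. econstructor; eauto. Qed.

Lemma finite_functions (N : Type) (l r : list N) : exists L : list (N -> N),
  forall f, (forall a, In a l -> In (f a) r) -> exists g, In g L /\ forall a, In a l -> g a = f a.
Proof.
  induction l as [|a l [L IH]].
  - exists [fun x => x]. intros f _. exists (fun x => x). split; [left; reflexivity|]. intros a [].
  - pose (upd := fun (gb : (N -> N) * N) x =>
             if excluded_middle_informative (x = a) then snd gb else fst gb x).
    exists (map upd (list_prod L r)). intros f Hf.
    destruct (IH f) as (g & Hg & Eg); [intros; apply Hf; right; auto|].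
    exists (upd (g, f a)). split.
    + apply in_map, in_prod; [exact Hg|]. apply Hf. left. reflexivity.
    + intros x Hx. unfold upd. simpl. destruct (excluded_middle_informative (x = a)) as [->|n]; [reflexivity|].
      apply Eg. destruct Hx; congruence.
Qed.

Lemma level_functions_finite k m : exists L : list (node D -> node D),
  forall F, (forall a, lev a = k -> lev (F a) = m) -> exists G, In G L /\ forall a, lev a = k -> G a = F a.
Proof.
  destruct (level_finite k) as [lk Hk], (level_finite m) as [lm Hm].
  pose (lk' := filter (fun a => lev a =? k) lk).
  destruct (finite_functions _ lk' lm) as [L HL]. exists L. intros F HF.
  destruct (HL F) as (G & HG & EG).
  - intros a Ha. apply filter_In in Ha. destruct Ha as [_ Ha]. apply Nat.eqb_eq in Ha. auto.
  - exists G. split; [exact HG|]. intros a La. apply EG, filter_In.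
    split; [auto|]. apply Nat.eqb_eq. exact La.
Qed.

Lemma Hom_finite k m : exists L : list (node D -> node D),
  forall F, Hom k m F -> exists G, In G L /\ forall a, lev a <= k -> G a = F a.
Proof.
  destruct (level_functions_finite k m) as [L HL].
  exists (map (fun g a => if lev a <? k then a else g a) L). intros F (_ & IF & LF).
  destruct (HL F LF) as (G & HG & EG).
  exists (fun a => if lev a <? k then a else G a). split.
  - exact (in_map (fun g a => if lev a <? k then a else g a) L G HG).
  - intros a La. destruct (lev a <? k) eqn:E.
    + apply Nat.ltb_lt in E. symmetry. auto.
    + apply Nat.ltb_ge in E. apply EG. lia.
Qed.

Lemma edge_finite k m : exists L : list approx, forall u, edge k u m -> In u L.
Proof.
  destruct (Hom_finite k (m - 1)) as [L HL]. exists (map (restr k) L).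
  intros u Hu. apply edge_iff in Hu. destruct Hu as (m' & F & -> & HF & ->).
  replace (S m' - 1) with m' in HL by lia. destruct (HL F HF) as (G & HG & EG).
  rewrite <- (restr_ext k G F) by exact EG. apply in_map. exact HG.
Qed.

Lemma fpath_finite k m : exists L : list (list approx), forall y, fpath k y m -> In y L.
Proof.
  remember (m - k) as n eqn:En. revert k En.
  induction n as [n IH] using lt_wf_ind. intros k En.
  (* [q] bounds the length of the first edge, so that its possible targets are added one at a
     time. *)
  assert (Hq : forall q, exists L : list (list approx), forall e k' y, k < k' <= k + q -> edge k e k' ->
             fpath k' y m -> In (e :: y) L).
  { induction q as [|q [L HL]]; [exists []; lia|].
    destruct (edge_finite k (S (k + q))) as [Le He].
    destruct (le_lt_dec (S (k + q)) m) as [Lm|Lm].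
    - destruct (IH (m - S (k + q)) ltac:(lia) (S (k + q)) eq_refl) as [L' HL'].
      exists (map (fun ey => fst ey :: snd ey) (list_prod Le L') ++ L).
      intros e k' y Hk Hed Hf. apply in_or_app.
      destruct (Nat.eq_dec k' (S (k + q))) as [->|ne].
      + left. apply in_map_iff. exists (e, y). split; [reflexivity|].
        apply in_prod; auto.
      + right. apply (HL e k' y); auto. lia.
    - exists L. intros e k' y Hk Hed Hf. apply (HL e k' y); auto.
      apply fpath_le in Hf. lia. }
  destruct (Hq (m - k)) as [L HL]. exists ([] :: L). intros y Hy.
  inversion Hy as [|? e k' y' ? He Hf]; subst; [left; reflexivity|right].
  apply (HL e k' y'); auto. apply edge_lt in He. apply fpath_le in Hf. lia.
Qed.

Lemma finite_shrink (I : Type) (L : list I) (Phi : I -> (nat -> approx) -> (nat -> nat) -> Prop) U c :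
  path U c ->
  (forall y U1 c1 U2 c2, path U1 c1 -> path U2 c2 -> c2 0 = c1 0 -> refines U2 c2 U1 c1 ->
     Phi y U1 c1 -> Phi y U2 c2) ->
  (forall y U1 c1, In y L -> path U1 c1 -> c1 0 = c 0 -> refines U1 c1 U c ->
     exists U2 c2, path U2 c2 /\ c2 0 = c1 0 /\ refines U2 c2 U1 c1 /\ Phi y U2 c2) ->
  exists U' c', path U' c' /\ c' 0 = c 0 /\ refines U' c' U c /\ forall y, In y L -> Phi y U' c'.
Proof.
  intros HU Hher Hex. induction L as [|y L IH].
  - exists U, c. split; [exact HU|]. split; [reflexivity|]. split; [apply refines_refl; auto|].
    intros y [].
  - destruct IH as (U1 & c1 & P1 & E1 & R1 & H1); [intros; eapply Hex; eauto; right; auto|].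
    destruct (Hex y U1 c1) as (U2 & c2 & P2 & E2 & R2 & H2); auto; [left; auto|].
    exists U2, c2. split; [exact P2|]. split; [congruence|].
    split; [exact (refines_trans _ _ _ _ _ _ P1 HU R2 R1)|].
    intros z [<-|Hz]; [exact H2|]. eapply Hher; [exact P1| | | |]; eauto.
Qed.

(** Before each edge is chosen, the tree above the current cut is shrunk so that [Phi] holds for
    every finite path from [c 0] to that cut. There are finitely many, and among them are all those
    inside the tree that is being built. *)
Lemma fusion (Phi : list approx -> (nat -> approx) -> (nat -> nat) -> Prop) U c :
  path U c ->
  (forall y U1 c1 U2 c2, path U1 c1 -> path U2 c2 -> c2 0 = c1 0 -> refines U2 c2 U1 c1 ->
     Phi y U1 c1 -> Phi y U2 c2) ->
  (forall y j U1 c1, path U1 c1 -> c1 0 = c j -> fpath (c 0) y (c j) ->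
     refines U1 c1 (shift j U) (shift j c) ->
     exists U2 c2, path U2 c2 /\ c2 0 = c1 0 /\ refines U2 c2 U1 c1 /\ Phi y U2 c2) ->
  exists U' c', path U' c' /\ c' 0 = c 0 /\ refines U' c' U c /\
    forall y j, fin_below U' c' 0 y j -> Phi y (shift j U') (shift j c').
Proof.
  intros HU Hher Hex.
  pose (good := fun S : (nat -> approx) * (nat -> nat) =>
    path (fst S) (snd S) /\
    (exists j, snd S 0 = c j /\ refines (fst S) (snd S) (shift j U) (shift j c)) /\
    forall y, fpath (c 0) y (snd S 0) -> Phi y (fst S) (snd S)).
  assert (Hshrink : forall j U1 c1, path U1 c1 -> c1 0 = c j -> refines U1 c1 (shift j U) (shift j c) ->
    exists S, good S /\ snd S 0 = c1 0 /\ refines (fst S) (snd S) U1 c1).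
  { intros j U1 c1 P1 E1 R1. destruct (fpath_finite (c 0) (c j)) as [L HL].
    (* [L] may contain lists that are not paths, for which no shrinking is provided. *)
    pose (L' := filter (fun y => if excluded_middle_informative (fpath (c 0) y (c j)) then true else false) L).
    destruct (finite_shrink _ L' Phi U1 c1 P1 Hher) as (U2 & c2 & P2 & E2 & R2 & H2).
    - intros y V cV Hy PV EV RV. apply filter_In in Hy. destruct Hy as [_ Hy].
      destruct (excluded_middle_informative (fpath (c 0) y (c j))) as [Hf|]; [|discriminate].
      apply (Hex y j); auto; [congruence|].
      exact (refines_trans _ _ _ _ _ _ P1 (path_shift _ _ _ HU) RV R1).
    - exists (U2, c2). simpl. split; [|split; auto]. split; [exact P2|]. split.
      + exists j. simpl. split; [congruence|].
        exact (refines_trans _ _ _ _ _ _ P1 (path_shift _ _ _ HU) R2 R1).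
      + simpl. intros y Hy. rewrite E2, E1 in Hy. apply H2. apply filter_In. split; [auto|].
        destruct (excluded_middle_informative (fpath (c 0) y (c j))); [reflexivity|contradiction]. }
  destruct (Hshrink 0 U c HU eq_refl (refines_refl _ _ HU)) as (S0 & G0 & E0 & R0).
  destruct (dependent_choice _ (fun _ => good)
    (fun _ S S' => snd S' 0 = snd S 1 /\ refines (fst S') (snd S') (shift 1 (fst S)) (shift 1 (snd S))) S0 G0)
    as (Ss & HS0 & HSs).
  { intros _ [U1 c1] (P1 & (j & Ej & Rj) & H1). simpl in *.
    destruct (refines_cut _ _ _ _ 1 Rj) as [i Ei].
    destruct (Hshrink (j + i) (shift 1 U1) (shift 1 c1)) as (S' & G' & E' & R').
    - apply path_shift, P1.
    - exact Ei.
    - rewrite <- !shift_shift. apply refines_shift; auto. apply path_shift, HU.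
    - exists S'. split; [exact G'|]. split; [exact E'|exact R']. }
  destruct (diagonal (fun n => fst (Ss n)) (fun n => snd (Ss n)) (fun _ => 1) (fun n => fst (Ss n) 0))
    as [PV RV].
  - intros n. apply HSs.
  - intros n. apply (HSs n).
  - intros n a y La H. apply comp_one. exact H.
  - intros n. apply (HSs n).
  - intros n. apply (HSs n).
  - exists (fun n => fst (Ss n) 0), (fun n => snd (Ss n) 0). split; [exact PV|].
    split; [rewrite HS0; exact E0|]. split.
    + eapply refines_trans; [apply (proj1 (HSs 0))| |apply (RV 0)|]; [exact HU|].
      rewrite HS0. exact R0.
    + intros y j Hy. apply fin_below_fpath in Hy. rewrite HS0, E0 in Hy.
      eapply Hher; [apply (proj1 (HSs j))| | |apply (RV j)|].
      * apply path_shift. exact PV.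
      * unfold shift. rewrite Nat.add_0_r. reflexivity.
      * apply (proj1 (HSs j)). exact Hy.
Qed.

(** * The pigeonhole principle *)

Lemma Hom_agree k m m' F G : Hom k m F -> Hom k m' G -> (forall a, lev a = k -> F a = G a) ->
  forall a, lev a <= k -> F a = G a.
Proof.
  intros (_ & I & _) (_ & I' & _) H a L.
  destruct (Nat.eq_dec (lev a) k) as [e|ne]; [auto|]. rewrite I, I' by lia. reflexivity.
Qed.

(* Morphisms that stay inside the fat tree [U]: [block_to] ends at the cut [c (i + d)],
   [block_before] one level below the cut [c (i + d + 1)]. *)
Definition block_to (U : nat -> approx) (c : nat -> nat) (i d : nat) (F : node D -> node D) : Prop :=
  Hom (c i) (c (i + d)) F /\ forall a, lev a = c i -> comp U i d a (F a).

Definition block_before (U : nat -> approx) (c : nat -> nat) (i d : nat) (F : node D -> node D) : Prop :=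
  Hom (c i) (pred (c (S (i + d)))) F /\
  forall a, lev a = c i -> exists b, comp U i d a b /\ U (i + d) b = Some (F a).

(** Total maps in place of the edges of [U], sharp so that they also carry the first level above a
    cut: by [rel_f], the lift of a node consists of the values of [f i] at its immediate
    successors. *)
Definition sharp_rep (U : nat -> approx) (c : nat -> nat) (f : nat -> node D -> node D) : Prop :=
  forall i, sharp (c i) (pred (c (S i))) (f i) /\ U i = restr (c i) (f i).

Lemma sharp_rep_ex U c : path U c -> exists f, sharp_rep U c f.
Proof.
  intros HP. apply (functional_choice_on nat (node D -> node D)
    (fun i F => sharp (c i) (pred (c (S i))) F /\ U i = restr (c i) F)). intros i.
  destruct (proj1 (edge_iff _ _ _) (HP i)) as (m & F & E & HF & EU).
  destruct (sharpen (c i) m F HF) as (G & HG & EG).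
  exists G. rewrite E. simpl. split; [exact HG|]. rewrite EU. symmetry. apply restr_ext. exact EG.
Qed.

Definition copying (cp : nat -> nat -> node D -> node D) : Prop :=
  forall n m, n < m -> Hom m (S m) (cp n m) /\
    forall b p s, lev b = m -> lab b n p s -> Sf b p s = Some (cp n m b).

Lemma copying_ex : exists cp, copying cp.
Proof.
  destruct (functional_choice_on (nat * nat) (node D -> node D)
    (fun nm F => fst nm < snd nm -> Hom (snd nm) (S (snd nm)) F /\
       forall b p s, lev b = snd nm -> lab b (fst nm) p s -> Sf b p s = Some (F b))) as [g Hg].
  - intros [n m]. simpl. destruct (le_lt_dec m n) as [L|L].
    + exists (fun a => a). lia.
    + destruct (copy_map n m L) as (F & HF). exists F. auto.
  - exists (fun n m => g (n, m)). intros n m. apply (Hg (n, m)).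
Qed.

(** * Blocks inside a fixed path, and words over copied labels *)

Section OnPath.
Context (U : nat -> approx) (c : nat -> nat) (HP : path U c).
Context (f : nat -> node D -> node D) (Hf : sharp_rep U c f).
Context (cp : nat -> nat -> node D -> node D) (Hcp : copying cp).

Lemma cut_S i : S (pred (c (S i))) = c (S i).
Proof. pose proof (edge_lt _ _ _ (HP i)). lia. Qed.

Lemma cut_le_pred i : c i <= pred (c (S i)).
Proof. pose proof (edge_lt _ _ _ (HP i)). lia. Qed.

Lemma Hom_f i : Hom (c i) (pred (c (S i))) (f i).
Proof. apply Hf. Qed.

Lemma U_f i a : lev a <= c i -> U i a = Some (f i a).
Proof. intros L. rewrite (proj2 (Hf i)). apply restr_le. exact L. Qed.

Lemma f_lev_succ i x : lev x = S (c i) -> lev (f i x) = c (S i).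
Proof. intros L. rewrite (proj2 (proj1 (Hf i))) by exact L. apply cut_S. Qed.

Lemma f_mono i a b : tle a b -> tle (f i a) (f i b).
Proof. apply M_mono. apply (Hom_f i). Qed.

Lemma rel_f i a y : lev a = c i ->
  (rel (U i) a y <-> exists x, tle a x /\ lev x = S (c i) /\ y = f i x).
Proof.
  intros La. split.
  - intros (p & s & x & a' & E1 & E2 & E3). rewrite U_f in E2 by lia. injection E2 as <-.
    rewrite (sharp_Sf _ _ _ _ _ _ _ (proj1 (Hf i)) La E1) in E3. injection E3 as <-.
    exists x. split; [eapply Sf_tle; eauto|]. split; [|reflexivity].
    rewrite (Sf_lev _ _ _ _ E1). lia.
  - intros (x & H & L & ->). destruct (Sf_ex a x H) as (p & s & E); [lia|].
    exists p, s, x, (f i a). split; [exact E|]. split; [apply U_f; lia|].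
    eapply sharp_Sf; [apply Hf|exact La|exact E].
Qed.

Lemma block_to_id i : block_to U c i 0 (fun a => a).
Proof.
  split; [rewrite Nat.add_0_r; apply Hom_id|]. intros a _. reflexivity.
Qed.

Lemma block_to_f i d v : block_to U c i d v -> block_before U c i d (fun a => f (i + d) (v a)).
Proof.
  intros [HV HC]. split; [eapply Hom_comp; [exact HV|apply Hom_f]|].
  intros a La. exists (v a). split; [auto|]. apply U_f. destruct HV as (_ & _ & L). rewrite L; auto.
Qed.

(** The factor [G] is forced: [H] moves nodes of level [l] upwards, so [G a] is the node of level
    [l] below [F a]. *)
Lemma Hom_truncate k l m F : Hom k m F -> k <= l -> l <= m ->
  exists G H, Hom k l G /\ Hom l m H /\ (forall a, lev a <= k -> H (G a) = F a) /\
    forall a b, lev a = k -> lev b = l -> tle b (F a) -> G a = b.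
Proof.
  intros HF L1 L2. destruct (Hom_factor k l m F HF L1 L2) as (G & H & HG & HH & E).
  exists G, H. split; [exact HG|]. split; [exact HH|]. split; [exact E|].
  intros a b La Lb Hb. assert (LG : lev (G a) = l) by (apply HG; exact La).
  apply (tle_below_eq (G a) b (F a)); [|exact Hb|lia].
  rewrite <- E by lia. apply (Hom_tle l m); [exact HH|lia].
Qed.

(** Truncating [F] at the cut [c (i + d)] recovers the intermediate nodes, which therefore form a
    single morphism. *)
Lemma block_before_f i d F : block_before U c i d F ->
  exists v, block_to U c i d v /\ forall a, lev a <= c i -> F a = f (i + d) (v a).
Proof.
  intros [HF HC]. pose proof (cut_le_pred (i + d)) as L.
  destruct (Hom_truncate (c i) (c (i + d)) _ F HF) as (v & h & Hv & Hh & _ & Ev).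
  - pose proof (path_mono U c i (i + d) HP). lia.
  - exact L.
  - assert (Hb : forall a, lev a = c i -> comp U i d a (v a) /\ F a = f (i + d) (v a)).
    { intros a La. destruct (HC a La) as (b & Cb & Eb).
      destruct (comp_lev U c i d a b HP La Cb) as [Lb _].
      rewrite U_f in Eb by lia. injection Eb as Eb.
      rewrite (Ev a b La Lb); [auto|]. rewrite <- Eb.
      apply (Hom_tle _ _ _ _ (Hom_f (i + d))). lia. }
    exists v. split; [split; [exact Hv|intros a La; apply Hb; exact La]|].
    apply (Hom_agree (c i) _ _ F _ HF (Hom_comp _ _ _ _ _ Hv (Hom_f (i + d)))).
    intros a La. apply Hb. exact La.
Qed.

Lemma block_to_prev i d v' : block_to U c i (S d) v' ->
  exists v, block_to U c i d v /\ forall a, lev a = c i -> rel (U (i + d)) (v a) (v' a).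
Proof.
  intros [HF HC]. rewrite Nat.add_succ_r in HF.
  destruct (Hom_truncate (c i) (c (i + d)) _ v' HF) as (v & h & Hv & Hh & _ & Ev).
  - pose proof (path_mono U c i (i + d) HP). lia.
  - pose proof (cut_le_pred (i + d)). lia.
  - assert (Hb : forall a, lev a = c i -> comp U i d a (v a) /\ rel (U (i + d)) (v a) (v' a)).
    { intros a La. destruct (comp_snoc_inv _ _ _ _ _ (HC a La)) as (b & Cb & Rb).
      destruct (comp_lev U c i d a b HP La Cb) as [Lb _].
      rewrite (Ev a b La Lb); [auto|]. eapply rel_lev; [apply HP|exact Lb|exact Rb]. }
    exists v. split; [split; [exact Hv|]|]; intros a La; apply Hb; exact La.
Qed.

Lemma block_before_comp i d d' v w : block_to U c i d v -> block_before U c (i + d) d' w ->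
  block_before U c i (d + d') (fun a => w (v a)).
Proof.
  intros [Hv Cv] [Hw Cw]. rewrite <- Nat.add_assoc in Hw. split; [eapply Hom_comp; eauto|].
  intros a La. assert (Lv : lev (v a) = c (i + d)) by (apply Hv; exact La).
  destruct (Cw (v a) Lv) as (b & Cb & Eb). exists b. rewrite Nat.add_assoc.
  split; [|exact Eb]. eapply comp_app; eauto.
Qed.

(** A lift takes all immediate successors, so any letter [r] may be inserted just above a cut
    without leaving [U]. *)
Lemma block_to_letter i d v r : block_to U c i d v -> Hom (c (i + d)) (S (c (i + d))) r ->
  block_to U c i (S d) (fun a => f (i + d) (r (v a))).
Proof.
  intros [Hv Cv] Hr.
  assert (Lr : forall a, lev a = c i -> lev (r (v a)) = S (c (i + d))).
  { intros a La. apply Hr. apply Hv. exact La. }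
  split.
  - split; [|split].
    + apply (M_comp (f (i + d)) (fun a => r (v a))); [apply (Hom_f (i + d))|].
      apply (M_comp r v); [apply Hr|apply Hv].
    + intros a La. pose proof (path_mono U c i (i + d) HP ltac:(lia)).
      destruct Hv as (_ & Iv & _). rewrite Iv by exact La.
      destruct Hr as (_ & Ir & _). rewrite Ir by lia.
      destruct (Hom_f (i + d)) as (_ & If & _). apply If. lia.
    + intros a La. rewrite Nat.add_succ_r. apply f_lev_succ. auto.
  - intros a La. eapply comp_snoc; [apply Cv; exact La|]. apply rel_f.
    + apply Hv. exact La.
    + exists (r (v a)). split; [|split; [auto|reflexivity]].
      apply (Hom_tle _ _ _ _ Hr). assert (lev (v a) = c (i + d)) by (apply Hv; exact La). lia.
Qed.

(** A label from a level below the cut [c (i + e)] is already present on the branch at that cut.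
    Copying it there and then following the edge of [U] gives the same node as copying it after the
    edge. *)
Lemma block_to_copy i e w n : block_before U c i e w -> n < c (i + e) ->
  block_to U c i (S e) (fun b => cp n (pred (c (S (i + e)))) (w b)).
Proof.
  intros HB Ln. set (m := pred (c (S (i + e)))).
  pose proof (cut_le_pred (i + e)) as Lm. fold m in Lm.
  destruct (Hcp n m) as [Hc Ec]; [lia|]. destruct HB as [Hw Cw]. split.
  - rewrite Nat.add_succ_r, <- cut_S. eapply Hom_comp; [exact Hw|exact Hc].
  - intros a La. destruct (Cw a La) as (b & Cb & Eb).
    destruct (comp_lev U c i e a b HP La Cb) as [Lb _].
    eapply comp_snoc; [exact Cb|].
    rewrite U_f in Eb by lia. injection Eb as Eb.
    assert (Tb : tle b (w a)) by (rewrite <- Eb; apply (Hom_tle _ _ _ _ (Hom_f (i + e))); lia).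
    assert (Lw : lev (w a) = m) by (apply Hw; exact La).
    destruct (lab_ex (w a) n) as (p & s & Hl); [lia|].
    pose proof (Ec (w a) p s Lw Hl) as E1.
    destruct (Hcp n (c (i + e)) Ln) as [_ Ec'].
    pose proof (Ec' b p s Lb (lab_below _ _ _ _ _ Hl Tb ltac:(lia))) as E2.
    exists p, s, (cp n (c (i + e)) b), (w a). split; [exact E2|]. split; [|exact E1].
    rewrite U_f by lia. f_equal. exact Eb.
Qed.

(** Letters are levels: [n] appends the label that the branch carries at level [n], from the level
    just before the cut [c s] onto the cut, and the edge of [U] from that cut follows. *)
Fixpoint word_map (s : nat) (y : list nat) (b : node D) : node D :=
  match y with
  | [] => b
  | n :: y' => word_map (S s) y' (f s (cp n (pred (c s)) b))
  end.

Lemma word_map_app s y y' b : word_map s (y ++ y') b = word_map (s + length y) y' (word_map s y b).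
Proof.
  revert s b. induction y as [|n y IH]; intros s b; simpl; [f_equal; lia|].
  rewrite IH. f_equal. lia.
Qed.

Lemma block_before_word y i e w : block_before U c i e w -> (forall n, In n y -> n < c (i + e)) ->
  block_before U c i (e + length y) (fun b => word_map (S (i + e)) y (w b)).
Proof.
  revert e w. induction y as [|n y IH]; intros e w Hw Hy; simpl.
  - rewrite Nat.add_0_r. exact Hw.
  - assert (Hn : n < c (i + e)) by (apply Hy; left; reflexivity).
    pose proof (block_to_f _ _ _ (block_to_copy i e w n Hw Hn)) as H.
    pose proof (IH (S e) _ H) as H2. rewrite !Nat.add_succ_r in *. apply H2.
    intros n' Hn'. specialize (Hy n' (or_intror Hn')).
    pose proof (cut_le_pred (i + e)). lia.
Qed.

(** Copying depends only on the label that is copied, and labels persist along a branch; hence two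
    levels with equal labels on [x] are interchangeable as values of the variable. *)
Lemma word_map_label z s x n m p t : 0 < c s ->
  (forall q, In (Some q) z -> q < pred (c s)) -> lev x = pred (c s) ->
  n < pred (c s) -> m < pred (c s) -> lab x n p t -> lab x m p t ->
  word_map s (subst n z) x = word_map s (subst m z) x.
Proof.
  revert s x. induction z as [|o z IH]; intros s x Hs Hz Lx Ln Lm Hn Hm; simpl; [reflexivity|].
  set (q := match o with Some q => q | None => n end).
  set (q' := match o with Some q => q | None => m end).
  assert (Lq : q < pred (c s)) by (destruct o; [apply Hz; left; reflexivity|exact Ln]).
  destruct (Hcp q (pred (c s)) Lq) as [Hq Eq].
  assert (E : cp q' (pred (c s)) x = cp q (pred (c s)) x).
  { destruct o as [q0|]; [reflexivity|]. unfold q, q' in *.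
    destruct (Hcp m (pred (c s)) Lm) as [_ Em].
    pose proof (Em x p t Lx Hm) as E1. pose proof (Eq x p t Lx Hn) as E2. congruence. }
  rewrite E. set (x' := cp q (pred (c s)) x).
  assert (Lx' : lev x' = c s).
  { unfold x'. destruct Hq as (_ & _ & L). rewrite L by exact Lx. lia. }
  assert (Tx : tle x (f s x')).
  { apply (tle_trans x x'); [apply (Hom_tle _ _ _ _ Hq); lia|].
    apply (Hom_tle _ _ _ _ (Hom_f s)). lia. }
  pose proof (cut_le_pred s) as Lc.
  apply IH; try lia.
  - intros q0 H0. specialize (Hz q0 (or_intror H0)). lia.
  - apply (Hom_f s). exact Lx'.
  - eapply lab_tle; [exact Hn|exact Tx].
  - eapply lab_tle; [exact Hm|exact Tx].
Qed.

Lemma word_map_tle y s x : 0 < c s -> (forall q, In q y -> q < pred (c s)) ->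
  lev x = pred (c s) -> tle x (word_map s y x).
Proof.
  revert s x. induction y as [|q y IH]; intros s x Hs Hy Lx; simpl; [apply tle_refl|].
  destruct (Hcp q (pred (c s))) as [(Mq & Iq & Lq) _]; [apply Hy; left; reflexivity|].
  set (x' := cp q (pred (c s)) x).
  assert (Lx' : lev x' = c s) by (unfold x'; rewrite Lq by exact Lx; lia).
  pose proof (cut_le_pred s) as Lc.
  apply (tle_trans x x').
  { apply (Hom_tle (pred (c s)) (S (pred (c s)))); [split; auto|lia]. }
  apply (tle_trans _ (f s x')); [apply (Hom_tle _ _ _ _ (Hom_f s)); lia|].
  apply IH; [lia| |apply (Hom_f s); exact Lx'].
  intros q' H'. specialize (Hy q' (or_intror H')). lia.
Qed.

(* [placed k0 k N w sg]: the label vector that turns [q] into [sg] (with [q : T(k0) -> T(k)])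
   occurs at one level below [N] on all branches of [w o q]. *)
Definition placed (k0 k N : nat) (w sg : node D -> node D) : Prop :=
  exists n, n < N /\ forall a b p t, lev a = k0 -> lev b = k -> Sf b p t = Some (sg a) -> lab (w b) n p t.

Lemma placed_tle k0 k N N' w w' sg : placed k0 k N w sg -> N <= N' ->
  (forall b, lev b = k -> tle (w b) (w' b)) -> placed k0 k N' w' sg.
Proof.
  intros (n & Ln & H) L HT. exists n. split; [lia|]. intros a b p t La Lb E.
  eapply lab_tle; eauto.
Qed.

(* A label vector realised right after [w] need not be available on all of [T(c (i + e + 1))]
   at that place, but it is after one more letter: apply an arbitrary letter first. *)
Lemma place_later k0 i e w q v' sg r :
  block_before U c i e w -> Hom k0 (c i) q -> Hom k0 (c (S (i + e))) v' ->
  Hom (c (i + e)) (S (c (i + e))) r ->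
  (forall a, lev a = k0 -> exists p t, Sf (q a) p t = Some (sg a) /\ Sf (w (q a)) p t = Some (v' a)) ->
  exists w', block_to U c i (S (S e)) w' /\ (forall b, lev b = c i -> tle (w b) (w' b)) /\
    placed k0 (c i) (c (i + S (S e))) w' sg.
Proof.
  intros HB Hq Hv' Hr Hlab. set (m := pred (c (S (i + e)))).
  pose proof (cut_le_pred (i + e)) as Lm. fold m in Lm.
  pose proof (cut_S (i + e)) as Sm. fold m in Sm. rewrite <- Sm in Hv'.
  assert (Li : c i <= c (i + e)) by (pose proof (path_mono U c i (i + e) HP ltac:(lia)); lia).
  pose proof (Hom_le _ _ _ Hq) as Lk.
  destruct HB as [Hw Cw]. fold m in Hw.
  destruct (Hom_truncate k0 m (S m) v' Hv') as (v1 & g & Hv1 & Hg & Eg & Ev1); [lia|lia|].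
  (* [g] is the letter that [v'] appends to [w o q]. *)
  assert (Gw : forall a, lev a = k0 -> g (w (q a)) = v' a).
  { intros a La. rewrite <- Eg by lia. f_equal. symmetry. apply Ev1; [exact La| |].
    - apply Hw, Hq, La.
    - destruct (Hlab a La) as (p & t & _ & E). eapply Sf_tle; eauto. }
  destruct (block_before_f i e w (conj Hw Cw)) as (w1 & Hw1 & Ew1).
  pose proof (block_to_letter i e w1 r Hw1 Hr) as Hl. destruct Hl as [Hl Cl].
  rewrite Nat.add_succ_r, <- Sm in Hl.
  destruct (Hom_truncate (c i) m (S m) _ Hl) as (w2 & la & Hw2 & Hla & Ela & Ew2); [lia|lia|].
  (* [lp] is the letter [r] seen from level [m]. Being sharp, it carries the successor [g (w a)] to
     a successor of [lp (w a)], which lies on a cut of [U], and it keeps the label. *)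
  destruct (sharpen m (S m) la Hla) as (lp & Hlp & Elp).
  assert (Law : forall a, lev a = c i -> comp U i (S e) a (lp (w a)) /\ lev (lp (w a)) = S m).
  { intros a La. assert (Lw : lev (w a) = m) by (apply Hw; exact La).
    rewrite Elp by lia. replace (w a) with (w2 a).
    - rewrite Ela by lia. split; [apply Cl; exact La|]. apply Hl. exact La.
    - apply Ew2; [exact La|exact Lw|]. rewrite Ew1 by lia. apply f_mono.
      apply (Hom_tle _ _ _ _ Hr). destruct Hw1 as [(_ & _ & L) _]. rewrite L; lia. }
  set (j := i + S e).
  assert (Lj : c j = S m) by (unfold j; rewrite Nat.add_succ_r; auto).
  assert (Tg : forall a, lev a = c i -> tle (lp (w a)) (lp (g (w a))) /\ lev (lp (g (w a))) = S (c j)).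
  { intros a La. assert (Lw : lev (w a) = m) by (apply Hw; exact La). split.
    - apply M_mono; [apply Hlp|]. apply (Hom_tle _ _ _ _ Hg). lia.
    - rewrite Lj. apply Hlp. apply Hg. exact Lw. }
  exists (fun a => f j (lp (g (w a)))). split; [|split].
  - split.
    + split; [|split].
      * apply (M_comp (f j) (fun a => lp (g (w a)))); [apply (Hom_f j)|].
        apply (M_comp lp (fun a => g (w a))); [apply Hlp|].
        apply (M_comp g w); [apply Hg|apply Hw].
      * intros a La. destruct Hw as (_ & Iw & _). rewrite Iw by exact La.
        destruct Hg as (_ & Ig & _). rewrite Ig by lia.
        destruct Hlp as [(_ & Il & _) _]. rewrite Il by lia.
        destruct (Hom_f j) as (_ & If & _). apply If. lia.
      * intros a La. replace (i + S (S e)) with (S j) by (unfold j; lia).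
        apply f_lev_succ. apply Tg. exact La.
    + intros a La. eapply comp_snoc; [apply Law; exact La|]. fold j. apply rel_f.
      * rewrite Lj. apply Law. exact La.
      * exists (lp (g (w a))). split; [apply Tg; exact La|]. split; [apply Tg; exact La|reflexivity].
  - intros b Lb. assert (Lw : lev (w b) = m) by (apply Hw; exact Lb).
    apply (tle_trans _ (lp (w b))); [apply (Hom_tle m (S m)); [apply Hlp|lia]|].
    apply (tle_trans _ (f j (lp (w b)))); [|apply f_mono, Tg; exact Lb].
    apply (Hom_tle _ _ _ _ (Hom_f j)). rewrite Lj. destruct (Law b Lb). lia.
  - replace (i + S (S e)) with (S j) by (unfold j; lia).
    (* The label sits at level [c j] before the last edge, which moves that level to
       [pred (c (S j))]. *)
    exists (pred (c (S j))). split; [pose proof (cut_S j); lia|].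
    intros a b p t La Lb E. destruct (Hlab a La) as (p' & t' & E1 & E2).
    destruct (Sf_inj _ _ _ _ _ _ _ E E1) as (-> & -> & ->).
    assert (Lw : lev (w (q a)) = m) by (apply Hw; exact Lb).
    rewrite <- (Gw a La) in E2. rename p' into p, t' into t.
    pose proof (sharp_Sf _ _ _ _ _ _ _ Hlp Lw E2) as E3.
    assert (Lx : lev (lp (w (q a))) = c j) by (rewrite Lj; apply Law; exact Lb).
    pose proof (sharp_Sf _ _ _ _ _ _ _ (proj1 (Hf j)) Lx E3) as E4.
    exists (f j (lp (w (q a)))), (f j (lp (g (w (q a))))). split; [apply (Hom_f j); exact Lx|].
    split; [exact E4|apply tle_refl].
Qed.

(** Greedy extension: for each vector in turn, extend the block so as to place it if this is
    possible. A placed vector stays placed, and one that no extension can place is not placed by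
    later extensions either. *)
Lemma place_all k0 i (G : list (node D -> node D)) :
  (exists r, Hom (c i) (S (c i)) r) ->
  exists d w, block_to U c i (S d) w /\ forall sg, In sg G ->
    placed k0 (c i) (c (i + S d)) w sg \/
    forall d' w', block_to U c i d' w' -> (forall b, lev b = c i -> tle (w b) (w' b)) ->
      ~ placed k0 (c i) (c (i + d')) w' sg.
Proof.
  intros (r & Hr). induction G as [|sg G (d & w & Hw & HG)].
  - pose proof (block_to_id i) as H0. apply (fun H => block_to_letter i 0 _ r H) in H0.
    + exists 0. eexists. split; [exact H0|]. intros sg [].
    + rewrite Nat.add_0_r. exact Hr.
  - destruct (classic (exists d' w', block_to U c i d' w' /\
      (forall b, lev b = c i -> tle (w b) (w' b)) /\ placed k0 (c i) (c (i + d')) w' sg))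
      as [(d' & w' & Hw' & HT & Hp)|Hno].
    (* An extension in the order of nodes cannot end at a lower cut, so it also consists of at least
       one edge. *)
    + assert (Ld : c (i + S d) <= c (i + d')).
      { destruct (level_nonempty (c i)) as [b Lb]. specialize (HT b Lb). apply tle_lev in HT.
        destruct Hw as [(_ & _ & L) _], Hw' as [(_ & _ & L') _].
        rewrite L, L' in HT by exact Lb. exact HT. }
      pose proof (path_le_inv U c _ _ HP Ld) as Ld'.
      destruct d' as [|d']; [lia|]. exists d', w'. split; [exact Hw'|].
      intros sg' [<-|Hs]; [left; exact Hp|]. destruct (HG sg' Hs) as [H|H].
      * left. eapply placed_tle; eauto.
      * right. intros d2 w2 H2 T2. apply H; [exact H2|]. intros b Lb.
        eapply tle_trans; eauto.
    + exists d, w. split; [exact Hw|]. intros sg' [<-|Hs]; [|auto].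
      right. intros d' w' H1 H2 H3. apply Hno. exists d', w'. auto.
Qed.

End OnPath.

Lemma block_before_edge U c i d F : path U c -> block_before U c i d F ->
  edge (c i) (restr (c i) F) (c (S (i + d))) /\ sub_edge (c i) (restr (c i) F) U i (S d).
Proof.
  intros HP HB. destruct (sharp_rep_ex U c HP) as [f Hf].
  destruct (block_before_f U c HP f Hf i d F HB) as (v & [Hv Cv] & Ev).
  split; [rewrite <- (cut_S U c HP); apply edge_restr; apply HB|].
  intros a y La (p & s & x & a' & E1 & E2 & E3).
  rewrite restr_le in E2 by lia. injection E2 as <-.
  eapply comp_snoc; [apply Cv; exact La|].
  destruct (Hom_Sf _ _ _ _ _ _ _ Hv (Nat.eq_le_incl _ _ La) E1) as (x' & E4 & _).
  exists p, s, x', (F a). split; [exact E4|]. split; [|exact E3].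
  rewrite Ev by lia. apply (U_f U c f Hf). apply Nat.eq_le_incl. apply Hv. exact La.
Qed.

(** Leaves contribute nothing to a lift, so an inclusion of lifts determines [F] only on nodes with
    a successor. For such a node, (S2) recovers [F a] from any successor of it in the lift. *)
Lemma sub_edge_block_before U c i d F :
  (forall a : node D, lev a = c i -> exists x, tle a x /\ lev x = S (lev a)) ->
  Hom (c i) (pred (c (S (i + d)))) F -> sub_edge (c i) (restr (c i) F) U i (S d) ->
  block_before U c i d F.
Proof.
  intros Hleaf HF HS. split; [exact HF|].
  intros a La. destruct (Hleaf a La) as (x & Hx & Lx).
  destruct (Sf_ex a x Hx Lx) as (p & s & E).
  destruct (Hom_Sf _ _ _ _ _ _ _ HF (Nat.eq_le_incl _ _ La) E) as (y & Ey & _).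
  destruct (comp_snoc_inv U i d a y) as (b & Cb & (p' & s' & x' & b' & _ & E2 & E3)).
  - apply HS; [exact La|]. exists p, s, x, (F a). rewrite restr_le by lia. auto.
  - exists b. split; [exact Cb|]. rewrite E2. f_equal. apply (Sf_inj _ _ _ _ _ _ _ E3 Ey).
Qed.

Lemma block_before_shift U c j i d F : block_before (shift j U) (shift j c) i d F <->
  block_before U c (j + i) d F.
Proof.
  unfold block_before, shift. rewrite Nat.add_succ_r, Nat.add_assoc.
  split; intros [H1 H2]; (split; [exact H1|]); intros a La; destruct (H2 a La) as (b & C & E);
    exists b; (split; [|exact E]); apply (comp_shift U j i d a b); exact C.
Qed.

(** Trades representatives that may lie outside [Q] for finitely many elements of [Q]. *)
Lemma finite_cover (X : Type) (R : X -> X -> Prop) (Q : X -> Prop) (L : list X) :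
  exists L', (forall y, In y L' -> Q y) /\
    forall x z, Q x -> In z L -> R z x -> exists y, In y L' /\ R z y.
Proof.
  induction L as [|z L (L' & H1 & H2)].
  - exists []. split; [intros y []|intros x z _ []].
  - destruct (classic (exists x, Q x /\ R z x)) as [(x & Qx & Rx)|Hno].
    + exists (x :: L'). split; [intros y [<-|Hy]; auto|].
      intros x' z' Qx' [<-|Hz] Rz.
      * exists x. split; [left; reflexivity|exact Rx].
      * destruct (H2 x' z' Qx' Hz Rz) as (y & Hy & Ry). exists y. split; [right|]; auto.
    + exists L'. split; [exact H1|]. intros x' z' Qx' [<-|Hz] Rz; [|eauto].
      exfalso. eauto.
Qed.

(** * Large sets of prefixes and the choice of good morphisms *)

Section Pigeonhole.
Context (k0 : nat) (P : (node D -> node D) -> Prop).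
Hypothesis P_ext : forall F G, (forall a, lev a <= k0 -> F a = G a) -> P F -> P G.
Hypothesis letter_ex : forall k, k0 <= k -> exists r, Hom k (S k) r.

Definition all_in (Q : (node D -> node D) -> Prop) (h : node D -> node D) : Prop :=
  forall v, Q v -> P (fun a => h (v a)).

Definition large (Q : (node D -> node D) -> Prop) (U : nat -> approx) (c : nat -> nat) : Prop :=
  forall U' c', path U' c' -> c' 0 = c 0 -> refines U' c' U c ->
    exists d h, block_before U' c' 0 d h /\ all_in Q h.

(** The label appended to [w (v a)] has to come from an immediate successor of [v a], as in a lift
    along the edge given by [w]. *)
Definition next_prefixes (Q : (node D -> node D) -> Prop) (w : node D -> node D) (m : nat)
  (v' : node D -> node D) : Prop :=
  Hom k0 m v' /\ exists v, Q v /\ forall a, lev a = k0 ->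
    exists p t x, Sf (v a) p t = Some x /\ Sf (w (v a)) p t = Some (v' a).

Lemma all_in_ext k (Q : (node D -> node D) -> Prop) h h' : (forall v, Q v -> Hom k0 k v) ->
  (forall a, lev a <= k -> h a = h' a) -> all_in Q h -> all_in Q h'.
Proof.
  intros HQ E H v Hv. apply (P_ext (fun a => h (v a))); [|auto].
  intros a La. apply E. eapply Hom_lev_le; eauto.
Qed.

Lemma no_leaf a : k0 <= lev a -> exists x : node D, tle a x /\ lev x = S (lev a).
Proof.
  intros L. destruct (letter_ex (lev a) L) as (r & Hr). exists (r a).
  split; [eapply Hom_tle; eauto|]. apply Hr. reflexivity.
Qed.

Lemma block_to_refines V cV U cU i j d e : path V cV -> path U cU -> refines V cV U cU ->
  cV i = cU j -> block_to V cV i d e -> exists d', block_to U cU j d' e /\ cU (j + d') = cV (i + d).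
Proof.
  intros HV HU HR E [He Ce].
  destruct (comp_refines V cV U cU i d HV HU HR) as (j' & d' & E1 & E2 & HC).
  assert (j' = j) as -> by (apply (path_inj U cU); [exact HU|congruence]).
  exists d'. split; [|congruence]. split; [rewrite <- E, <- E2; exact He|].
  intros a La. apply HC; [congruence|]. apply Ce. congruence.
Qed.

Lemma block_before_refines V cV U cU i j d h : path V cV -> path U cU -> refines V cV U cU ->
  cV i = cU j -> k0 <= cV i -> block_before V cV i d h ->
  exists d', block_before U cU j d' h /\ cU (S (j + d')) = cV (S (i + d)).
Proof.
  intros HV HU HR E Lk Hh.
  destruct (block_before_edge V cV i d h HV Hh) as [He HS].
  destruct (comp_refines V cV U cU i (S d) HV HU HR) as (j' & d' & E1 & E2 & HC).
  assert (j' = j) as -> by (apply (path_inj U cU); [exact HU|congruence]).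
  rewrite Nat.add_succ_r in E2. destruct d' as [|d'].
  { apply edge_lt in He. rewrite Nat.add_0_r in E2. lia. }
  rewrite Nat.add_succ_r in E2.
  exists d'. split; [|congruence]. apply sub_edge_block_before.
  - intros a La. apply no_leaf. lia.
  - rewrite <- E, <- E2. apply Hh.
  - rewrite <- E. intros a y La Hr. apply HC; [exact La|]. apply HS; auto.
Qed.

(** The last hypothesis is the situation left by fusion when no good [w] has a good continuation.
    The block [t] defeats all prefixes [e] up to the cut [i] at once, so it can serve as the next
    edge of a tree without good morphisms. *)
Lemma escape U c (Q : (node D -> node D) -> Prop) i : path U c ->
  (forall v, Q v -> Hom k0 (c 0) v) -> k0 <= c 0 ->
  (forall d w, block_before U c 0 d w -> all_in Q w ->
     forall d' h, block_before U c (S d) d' h -> ~ all_in (next_prefixes Q w (c (S d))) h) ->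
  exists d t, block_before U c i d t /\
    forall e, block_to U c 0 i e -> ~ all_in Q (fun a => t (e a)).
Proof.
  intros HP HQ Lk Hstar. apply NNPP. intros Hno.
  assert (Hcol : forall d t, block_before U c i d t ->
            exists e, block_to U c 0 i e /\ all_in Q (fun a => t (e a))).
  { intros d t Ht. apply NNPP. intros Hn. apply Hno. exists d, t. split; [exact Ht|].
    intros e He Ha. apply Hn. eauto. }
  destruct (sharp_rep_ex U c HP) as [f Hf]. destruct copying_ex as [cp Hcp].
  assert (Lki : k0 <= c i) by (pose proof (path_mono U c 0 i HP ltac:(lia)); lia).
  (* [G] lists candidates for every letter that can follow a prefix [e o v]. *)
  destruct (level_functions_finite k0 (S (c i))) as [G HG].
  destruct (place_all U c HP f Hf k0 i G (letter_ex (c i) Lki)) as (d0 & w0 & Hw0 & Hplace).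
  set (s0 := i + S d0) in *.
  assert (Ps0 : 0 < c s0).
  { unfold s0. rewrite Nat.add_succ_r. pose proof (cut_S U c HP (i + d0)). lia. }
  set (t := fun y b => word_map c f cp (S s0) y (f s0 (w0 b))).
  assert (Ht : forall y, (forall n, In n y -> n < c s0) -> block_before U c i (S d0 + length y) (t y)).
  { intros y Hy. apply (block_before_word U c HP f Hf cp Hcp y i (S d0) (fun b => f s0 (w0 b))); [|exact Hy].
    apply (block_to_f U c f Hf). exact Hw0. }
  (* The alphabet consists of the levels below the end of [w0], where all letters that can be placed
     have been placed. *)
  set (A := seq 0 (c s0)).
  assert (HA : forall n, In n A <-> n < c s0) by (intros n; unfold A; rewrite in_seq; lia).
  (* The colours are finitely many prefixes inside [U], representing all others up to agreement on
     T(<= c 0). *)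
  destruct (Hom_finite (c 0) (c i)) as [L0 HL0].
  destruct (finite_cover _ (fun g e => forall a, lev a <= c 0 -> g a = e a) (block_to U c 0 i) L0)
    as (L & HL1 & HL2).
  assert (Hk : forall y, exists e, incl y A -> In e L /\ all_in Q (fun a => t y (e a))).
  { intros y. destruct (classic (incl y A)) as [Hy|Hy]; [|exists (fun a => a); contradiction].
    destruct (Hcol _ _ (Ht y ltac:(intros n Hn; apply HA; auto))) as (e & He & Ha).
    destruct (HL0 e (proj1 He)) as (g & Hg & Eg).
    destruct (HL2 e g He Hg Eg) as (e' & He' & Ee').
    exists e'. intros _. split; [exact He'|].
    apply (all_in_ext (c 0) Q (fun a => t y (e a))); [exact HQ| |exact Ha].
    intros a La. rewrite <- Eg, Ee' by exact La. reflexivity. }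
  apply functional_choice_on in Hk. destruct Hk as [k Hk].
  assert (HA0 : A <> []).
  { intros E. apply (in_nil (a := 0)). rewrite <- E. apply HA. exact Ps0. }
  destruct (line_with_prefix A HA0 (length L)) as [N HN].
  destruct (HN _ L k (le_n _)) as (w & z & Hw & Hz & Hline); [intros y Hy _; apply Hk; exact Hy|].
  clear HN. set (e0 := k w) in *.
  destruct (Hk w Hw) as [He0 Hall0]. fold e0 in He0, Hall0. apply HL1 in He0.
  assert (Hw' : forall n, In n w -> n < c s0) by (intros n Hn; apply HA; auto).
  pose proof (Ht w Hw') as Htw. set (d1 := S d0 + length w) in *.
  set (s := S (i + d1)).
  set (m := pred (c s)).
  assert (Sm : S m = c s) by apply (cut_S U c HP).
  assert (Ls : c s0 <= m).
  { pose proof (cut_le_pred U c HP (i + d1)). fold s in H. fold m in H.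
    pose proof (path_mono U c s0 (i + d1) HP ltac:(unfold s0, d1; lia)). lia. }
  pose proof (cut_le_pred U c HP s) as Lcs.
  (* The variable is filled with [m], the level just before the cut [c s], so that it repeats
     whatever letter has just been appended there. *)
  set (h := fun b => word_map c f cp (S s) (subst m z) (f s b)).
  assert (Vz : forall n, n < c s -> forall q, In q (subst n z) -> q < c s).
  { intros n Hn q Hq. apply in_map_iff in Hq. destruct Hq as ([q'|] & <- & Hq); [|exact Hn].
    apply Hz, HA in Hq. lia. }
  assert (Hh : block_before U c s (length z) h).
  { pose proof (block_to_f U c f Hf s 0 _ (block_to_id U c s)) as H0.
    pose proof (block_before_word U c HP f Hf cp Hcp (subst m z) s 0 _ H0) as H1.
    rewrite !Nat.add_0_r, length_subst in H1. apply H1. apply Vz. lia. }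
  assert (Hte : block_before U c 0 (i + d1) (fun a => t w (e0 a))).
  { apply (block_before_comp U c 0 i d1 e0 (t w) He0 Htw). }
  (* [t w o e0] is good, so [h] must fail at some one-letter extension [v']; the rest derives [P]
     for [h o v']. *)
  pose proof (Hstar _ _ Hte Hall0 _ _ Hh) as Hn.
  apply not_all_ex_not in Hn. destruct Hn as [v' Hn].
  apply imply_to_and in Hn. destruct Hn as [(Hv' & v & Hv & Hlab) HnP].
  apply HnP. fold s in Hv', Hlab.
  pose proof (HQ v Hv) as HomV.
  assert (Hq : Hom k0 (c i) (fun a => e0 (v a))) by (eapply Hom_comp; [exact HomV|apply He0]).
  set (q := fun a => e0 (v a)) in *.
  assert (Hsg : forall a, exists x, lev a = k0 ->
            exists p l, Sf (q a) p l = Some x /\ Sf (t w (q a)) p l = Some (v' a)).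
  { intros a. destruct (Nat.eq_dec (lev a) k0) as [La|La]; [|exists a; contradiction].
    destruct (Hlab a La) as (p & l & x & E1 & E2).
    assert (Lv : lev (v a) = c 0) by (apply HomV; exact La).
    destruct (Hom_Sf _ _ _ _ _ _ _ (proj1 He0) (Nat.eq_le_incl _ _ Lv) E1) as (x' & E3 & _).
    exists x'. intros _. exists p, l. auto. }
  apply functional_choice_on in Hsg. destruct Hsg as [sg0 Hsg0].
  destruct (HG sg0) as (sg & HsgG & Esg).
  { intros a La. destruct (Hsg0 a La) as (p & l & E & _). rewrite (Sf_lev _ _ _ _ E).
    f_equal. apply Hq. exact La. }
  assert (Hsg : forall a, lev a = k0 ->
            exists p l, Sf (q a) p l = Some (sg a) /\ Sf (t w (q a)) p l = Some (v' a)).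
  { intros a La. rewrite Esg by exact La. auto. }
  assert (Htle : forall b, lev b = c i -> tle (w0 b) (t w b)).
  { intros b Lb. assert (Lw : lev (w0 b) = c s0) by (apply Hw0; exact Lb).
    pose proof (cut_le_pred U c HP s0).
    apply (tle_trans _ (f s0 (w0 b))); [apply (Hom_tle _ _ _ _ (Hom_f U c f Hf s0)); lia|].
    apply (word_map_tle U c HP f Hf cp Hcp).
    - pose proof (cut_S U c HP s0). lia.
    - intros n Hn. specialize (Hw' n Hn). lia.
    - apply (Hom_f U c f Hf s0). exact Lw. }
  (* Otherwise [sg] could never be placed, yet it occurs right after [t w] and [place_later] would
     place it. *)
  assert (Hp : placed k0 (c i) (c s0) w0 sg).
  { destruct (Hplace sg HsgG) as [Hp|Hnp]; [exact Hp|exfalso].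
    destruct (letter_ex (c (i + d1))) as [r Hr].
    { pose proof (path_mono U c i (i + d1) HP ltac:(lia)). lia. }
    destruct (place_later U c HP f Hf k0 i d1 (t w) q v' sg r Htw Hq Hv' Hr Hsg)
      as (w' & Hw1 & Hw2 & Hw3).
    apply (Hnp _ w' Hw1); [|exact Hw3].
    intros b Lb. apply (tle_trans _ (t w b)); auto. }
  destruct Hp as (n & Ln & Hn).
  assert (Hnw : incl (w ++ n :: subst n z) A).
  { apply incl_app; [exact Hw|]. apply incl_cons; [apply HA; exact Ln|].
    apply subst_over; [exact Hz|apply HA; exact Ln]. }
  (* The word [w ++ n :: z(n)] has the colour [e0]; its block after [e0 o v] is shown to be
     [h o v']. *)
  destruct (Hk _ Hnw) as [_ Hall]. rewrite (Hline n) in Hall by (apply HA; exact Ln). fold e0 in Hall.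
  specialize (Hall v Hv). refine (P_ext _ _ _ Hall).
  assert (Hbig : block_before U c i (S d0 + length (w ++ n :: subst n z)) (t (w ++ n :: subst n z))).
  { apply Ht. intros x Hx. apply HA. auto. }
  apply (Hom_agree k0 _ _ _ _ (Hom_comp _ _ _ _ _ Hq (proj1 Hbig)) (Hom_comp _ _ _ _ _ Hv' (proj1 Hh))).
  intros a La. fold q.
  destruct (Hsg a La) as (p & l & E1 & E2).
  assert (Lq : lev (q a) = c i) by (apply Hq; exact La).
  pose proof (Hn a (q a) p l La Lq E1) as Hl0.
  assert (Ltw : lev (t w (q a)) = m) by (apply Htw; exact Lq).
  pose proof (lab_tle _ _ _ _ _ Hl0 (Htle _ Lq)) as Hl1.
  destruct (Hcp n m) as [Hcn Ecn]; [lia|].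
  assert (Ecp : cp n m (t w (q a)) = v' a).
  { pose proof (Ecn _ _ _ Ltw Hl1) as E3. congruence. }
  assert (Lv' : lev (v' a) = c s) by (apply Hv'; exact La).
  change (t (w ++ n :: subst n z) (q a)) with
    (word_map c f cp (S s0) (w ++ n :: subst n z) (f s0 (w0 (q a)))).
  rewrite word_map_app.
  change (word_map c f cp (S s0) w (f s0 (w0 (q a)))) with (t w (q a)).
  replace (S s0 + length w) with s by (unfold s, s0, d1; lia).
  simpl. fold m. rewrite Ecp. unfold h.
  assert (Tv : tle (v' a) (f s (v' a))) by (apply (Hom_tle _ _ _ _ (Hom_f U c f Hf s)); lia).
  pose proof (Sf_tle _ _ _ _ E2) as Tt.
  (* After the letter [n] the branch carries [(p, l)] at level [n], where it was placed, and at
     level [m], where it was just copied. *)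
  apply (word_map_label U c HP f Hf cp Hcp z (S s) _ n m p l); try lia.
  - intros x Hx. apply Hz, HA in Hx. lia.
  - apply (Hom_f U c f Hf s). exact Lv'.
  - eapply lab_tle; [exact Hl1|]. eapply tle_trans; eauto.
  - exists (t w (q a)), (v' a). auto.
Qed.

(** If it fails, fusion yields [U'] in which no good [w] has a good continuation. Blocks from
    [escape] then form a path [V] without good morphisms, against largeness. *)
Lemma large_step U c (Q : (node D -> node D) -> Prop) : path U c ->
  (forall v, Q v -> Hom k0 (c 0) v) -> k0 <= c 0 -> large Q U c ->
  exists d w U' c', block_before U c 0 d w /\ all_in Q w /\ path U' c' /\ c' 0 = c (S d) /\
    refines U' c' (shift (S d) U) (shift (S d) c) /\ large (next_prefixes Q w (c (S d))) U' c'.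
Proof.
  intros HP HQ Lk HL. apply NNPP. intros Hno.
  (* Only one-edge paths matter: [y] is the edge of a good [w], and the tree above it shall contain
     nothing good for the next prefixes. *)
  destruct (fusion (fun y U1 c1 => forall d w, y = [restr (c 0) w] -> block_before U c 0 d w ->
      c (S d) = c1 0 -> all_in Q w -> forall d' h, block_before U1 c1 0 d' h ->
      ~ all_in (next_prefixes Q w (c1 0)) h) U c HP) as (U' & c' & P' & E' & R' & HU').
  - intros y U1 c1 U2 c2 P1 P2 E R H d w Ey Hw Ec Ha d' h Hh.
    destruct (block_before_refines U2 c2 U1 c1 0 0 d' h P2 P1 R E) as (d2 & Hh2 & _); [|exact Hh|].
    + rewrite <- Ec. pose proof (path_mono U c 0 (S d) HP ltac:(lia)). lia.
    + rewrite E. apply (H d w Ey Hw ltac:(congruence) Ha d2 h Hh2).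
  - intros y j U1 c1 P1 E1 _ R1.
    destruct (classic (exists d w, y = [restr (c 0) w] /\ block_before U c 0 d w /\
                c (S d) = c1 0 /\ all_in Q w)) as [(d & w & Ey & Hw & Ec & Ha)|Hn].
    + assert (j = S d) as -> by (apply (path_inj U c); [exact HP|congruence]).
      assert (HnL : ~ large (next_prefixes Q w (c (S d))) U1 c1).
      { intros HL1. apply Hno. exists d, w, U1, c1. auto 10. }
      apply not_all_ex_not in HnL. destruct HnL as [U2 HnL].
      apply not_all_ex_not in HnL. destruct HnL as [c2 HnL].
      apply imply_to_and in HnL. destruct HnL as [P2 HnL].
      apply imply_to_and in HnL. destruct HnL as [E2 HnL].
      apply imply_to_and in HnL. destruct HnL as [R2 HnL].
      exists U2, c2. split; [exact P2|]. split; [exact E2|]. split; [exact R2|].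
      intros d2 w2 Ey2 Hw2 Ec2 Ha2 d' h Hh Hall. apply HnL. exists d', h. split; [exact Hh|].
      intros v' (Hv' & v & Hv & Hlab). apply Hall. rewrite E2, <- Ec. split; [exact Hv'|].
      exists v. split; [exact Hv|]. intros a La. destruct (Hlab a La) as (p & t & x & F1 & F2).
      exists p, t, x. split; [exact F1|]. rewrite <- F2. f_equal.
      rewrite Ey in Ey2. injection Ey2 as Ey2. symmetry. apply (restr_inj (c 0)); [exact Ey2|].
      apply Nat.eq_le_incl, (HQ v Hv). exact La.
    + exists U1, c1. split; [exact P1|]. split; [reflexivity|]. split; [apply refines_refl; exact P1|].
      intros d w Ey Hw Ec Ha. exfalso. apply Hn. exists d, w. auto.
  - assert (Hesc : forall i, exists dt, block_before U' c' i (fst dt) (snd dt) /\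
              forall e, block_to U' c' 0 i e -> ~ all_in Q (fun a => snd dt (e a))).
    { intros i. destruct (escape U' c' Q i P') as (d & t & H).
      - rewrite E'. exact HQ.
      - lia.
      - intros d w Hw Ha d' h Hh.
        destruct (block_before_edge U' c' 0 d w P' Hw) as [He Hs].
        destruct (block_before_refines U' c' U c 0 0 d w P' HP R' E') as (d1 & Hw1 & Ed1);
          [lia|exact Hw|].
        pose proof (HU' [restr (c' 0) w] (S d)) as H1.
        assert (Hcut : shift (S d) c' 0 = c' (S d)) by (unfold shift; f_equal; lia).
        rewrite Hcut in H1. refine (H1 _ d1 w _ Hw1 Ed1 Ha d' h _).
        + apply (fb_cons U' c' 0 (S d)); [exact He|exact Hs|constructor].
        + rewrite E'. reflexivity.
        + apply block_before_shift. rewrite Nat.add_0_r. exact Hh.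
      - exists (d, t). exact H. }
    apply functional_choice_on in Hesc. destruct Hesc as [dt Hdt].
    set (step := fun i => S (fst (dt i))).
    (* The cuts of [U'] that are kept: from the cut [I n], the block found by [escape] is the next
       edge of [V]. *)
    set (I := fix I n := match n with 0 => 0 | S n' => I n' + step (I n') end).
    destruct (diagonal (fun n => shift (I n) U') (fun n => shift (I n) c') (fun n => step (I n))
      (fun n => restr (c' (I n)) (snd (dt (I n))))) as [PV RV].
    + intros n. apply path_shift, P'.
    + intros n. unfold shift, step. rewrite Nat.add_0_r, Nat.add_succ_r.
      exact (proj1 (block_before_edge U' c' _ _ _ P' (proj1 (Hdt (I n))))).
    + intros n a y La Hr. apply comp_shift. unfold shift in La, Hr. rewrite Nat.add_0_r in *.
      exact (proj2 (block_before_edge U' c' _ _ _ P' (proj1 (Hdt (I n)))) a y La Hr).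
    + intros n. unfold shift. simpl. f_equal. lia.
    + intros n. rewrite !shift_shift. simpl. apply refines_refl, path_shift, P'.
    + set (V := fun n => restr (c' (I n)) (snd (dt (I n)))) in *.
      set (cV := fun n => shift (I n) c' 0) in *.
      assert (RV0 : refines V cV U' c') by apply (RV 0).
      assert (EcV : forall n, cV n = c' (I n)) by (intros n; unfold cV, shift; f_equal; lia).
      destruct (HL V cV PV) as (d & h & Hh & Ha).
      * rewrite EcV. exact E'.
      * exact (refines_trans _ _ _ _ _ _ P' HP RV0 R').
      (* A good [h] inside [V] is [t o v], with [v] a prefix in [U'] up to some cut [I d] and [t]
         the block chosen to defeat it. *)
      * destruct (sharp_rep_ex V cV PV) as [f Hf].
        destruct (block_before_f V cV PV f Hf 0 d h Hh) as (v & Hv & Ev).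
        destruct (block_to_refines V cV U' c' 0 0 d v PV P' RV0 (EcV 0) Hv) as (i & Hi & Ei).
        assert (i = I d) as -> by (apply (path_inj U' c'); [exact P'|]; rewrite <- EcV; exact Ei).
        apply (proj2 (Hdt (I d)) v Hi).
        apply (all_in_ext (c 0) Q h); [exact HQ| |exact Ha].
        intros a La. rewrite <- E' in La. rewrite Ev by exact La.
        assert (Lv : lev (v a) <= cV d) by (apply (Hom_lev_le _ _ _ _ (proj1 Hv)); exact La).
        apply (restr_inj (cV d)); [|exact Lv].
        rewrite EcV. change (restr (c' (I d)) (snd (dt (I d)))) with (V d).
        rewrite <- EcV. symmetry. apply (Hf d).
Qed.

(** Iterates [large_step] from the trivial prefixes. Each chosen [w] is good for a set containing
    all prefixes inside [V] up to its cut, and a block of [V] is such a prefix followed by such a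
    [w]. *)
Lemma large_homogeneous U c : path U c -> c 0 = k0 -> large (Hom k0 k0) U c ->
  exists U' c', path U' c' /\ c' 0 = c 0 /\ refines U' c' U c /\
    forall d h, block_before U' c' 0 d h -> P h.
Proof.
  intros HP Ec HL.
  set (state := (((node D -> node D) -> Prop) * ((nat -> @approx D) * (nat -> nat)))%type).
  pose (inv := fun s : state => path (fst (snd s)) (snd (snd s)) /\
    (forall v, fst s v -> Hom k0 (snd (snd s) 0) v) /\ k0 <= snd (snd s) 0 /\
    large (fst s) (fst (snd s)) (snd (snd s))).
  pose (step := fun (s s' : state) (dw : nat * (node D -> node D)) =>
    block_before (fst (snd s)) (snd (snd s)) 0 (fst dw) (snd dw) /\ all_in (fst s) (snd dw) /\
    snd (snd s') 0 = snd (snd s) (S (fst dw)) /\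
    refines (fst (snd s')) (snd (snd s')) (shift (S (fst dw)) (fst (snd s))) (shift (S (fst dw)) (snd (snd s))) /\
    fst s' = next_prefixes (fst s) (snd dw) (snd (snd s) (S (fst dw)))).
  destruct (dependent_choice state (fun _ => inv) (fun _ s s' => exists dw, step s s' dw)
    (Hom k0 k0, (U, c))) as (Ss & H0 & HSs).
  - split; [exact HP|]. simpl. rewrite Ec. auto.
  - intros _ [Q [U1 c1]] (P1 & HQ & Lk & HL1). simpl in *.
    destruct (large_step U1 c1 Q P1 HQ Lk HL1) as (d & w & U2 & c2 & Hw & Ha & P2 & E2 & R2 & HL2).
    exists (next_prefixes Q w (c1 (S d)), (U2, c2)). split.
    + split; [exact P2|]. simpl. rewrite E2. split; [intros v Hv; apply Hv|]. split; [|exact HL2].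
      pose proof (path_mono U1 c1 0 (S d) P1 ltac:(lia)). lia.
    + exists (d, w). repeat (split; [assumption|]). reflexivity.
  - destruct (functional_choice_on _ _ (fun n dw => step (Ss n) (Ss (S n)) dw)) as [dw Hdw].
    { intros n. apply (HSs n). }
    set (Qs := fun n => fst (Ss n)). set (Us := fun n => fst (snd (Ss n))).
    set (cs := fun n => snd (snd (Ss n))). set (ds := fun n => fst (dw n)). set (ws := fun n => snd (dw n)).
    assert (HPn : forall n, path (Us n) (cs n)) by (intros n; apply (HSs n)).
    assert (Hw : forall n, block_before (Us n) (cs n) 0 (ds n) (ws n)) by (intros n; apply (Hdw n)).
    destruct (diagonal Us cs (fun n => S (ds n)) (fun n => restr (cs n 0) (ws n))) as [PV RV].
    + exact HPn.
    + intros n. apply (block_before_edge _ _ 0 _ _ (HPn n) (Hw n)).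
    + intros n. apply (block_before_edge _ _ 0 _ _ (HPn n) (Hw n)).
    + intros n. apply (Hdw n).
    + intros n. apply (Hdw n).
    + set (V := fun n => restr (cs n 0) (ws n)) in *. set (cV := fun n => cs n 0) in *.
      assert (E0 : cV 0 = k0) by (unfold cV, cs; rewrite H0; exact Ec).
      exists V, cV. split; [exact PV|]. split; [congruence|]. split.
      { pose proof (RV 0) as R. unfold Us, cs in R. rewrite H0 in R. exact R. }
      assert (Hpre : forall n v, block_to V cV 0 n v -> Qs n v).
      { induction n as [|n IH]; intros v Hv.
        - unfold Qs. rewrite H0. simpl. pose proof (proj1 Hv) as H. simpl in H.
          rewrite E0 in H. exact H.
        - destruct (block_to_prev V cV PV 0 n v Hv) as (v0 & Hv0 & Hr).
          destruct (Hdw n) as (_ & _ & Ecn & _ & EQ).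
          change (fst (Ss (S n))) with (Qs (S n)) in EQ. rewrite EQ. split.
          + rewrite <- Ecn. pose proof (proj1 Hv) as H. rewrite E0 in H. exact H.
          + exists v0. split; [apply IH; exact Hv0|]. intros a La. rewrite <- E0 in La.
            destruct (Hr a La) as (p & t & x & a' & F1 & F2 & F3).
            exists p, t, x. split; [exact F1|]. rewrite <- F3. f_equal.
            unfold V in F2. simpl in F2. rewrite restr_le in F2; [injection F2 as <-; reflexivity|].
            apply Nat.eq_le_incl. apply (proj1 Hv0). exact La. }
      intros d h Hh. destruct (sharp_rep_ex V cV PV) as [f Hf].
      destruct (block_before_f V cV PV f Hf 0 d h Hh) as (v & Hv & Ev).
      destruct (Hdw d) as (_ & Ha & _). specialize (Ha v (Hpre d v Hv)).
      refine (P_ext _ _ _ Ha). intros a La. rewrite <- E0 in La. rewrite Ev by exact La.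
      apply (restr_inj (cV d)); [apply (Hf d)|].
      apply (Hom_lev_le _ _ _ _ (proj1 Hv)). exact La.
Qed.

End Pigeonhole.

(** One-letter morphisms exist from every positive level by (M3). If there is none from level 0 and
    [c 0 = 0], then by factorisation the only edge from 0 is the identity of T(0), and [U] itself
    works. *)
Lemma pigeonhole U c (E : approx -> Prop) : path U c ->
  exists U' c', path U' c' /\ c' 0 = c 0 /\ refines U' c' U c /\
    ((forall e j, edge (c 0) e (c' j) -> sub_edge (c 0) e U' 0 j -> E e) \/
     (forall e j, edge (c 0) e (c' j) -> sub_edge (c 0) e U' 0 j -> ~ E e)).
Proof.
  intros HP.
  destruct (classic (c 0 = 0 -> exists r, Hom 0 1 r)) as [Hlet|Hlet].
  - assert (letters : forall k, c 0 <= k -> exists r, Hom k (S k) r).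
    { intros [|k] L; [apply Hlet; lia|].
      destruct (copy_map 0 (S k)) as (r & Hr & _); [lia|]. eauto. }
    set (P := fun F => E (restr (c 0) F)).
    assert (P_ext : forall F G, (forall a, lev a <= c 0 -> F a = G a) -> P F -> P G).
    { intros F G H. unfold P. rewrite (restr_ext _ F G H). auto. }
    assert (Hred : forall U' c' e j, path U' c' -> c' 0 = c 0 -> edge (c 0) e (c' j) ->
              sub_edge (c 0) e U' 0 j -> exists d F, e = restr (c 0) F /\ block_before U' c' 0 d F).
    { intros U' c' e [|d] P' E' He Hs.
      - apply edge_lt in He. lia.
      - apply edge_iff in He. destruct He as (m & F & Em & HF & ->). exists d, F.
        split; [reflexivity|]. apply sub_edge_block_before.
        + intros a La. apply (no_leaf (c 0)); [exact letters|lia].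
        + rewrite E'. simpl. rewrite Em. exact HF.
        + rewrite E'. exact Hs. }
    destruct (classic (large P (Hom (c 0) (c 0)) U c)) as [HL|HL].
    + destruct (large_homogeneous (c 0) P P_ext letters U c HP eq_refl HL) as (U' & c' & P' & E' & R' & H).
      exists U', c'. split; [exact P'|]. split; [exact E'|]. split; [exact R'|]. left.
      intros e j He Hs. destruct (Hred U' c' e j P' E' He Hs) as (d & F & -> & HF).
      apply (H d F HF).
    (* A witness against largeness is a tree none of whose edges from [c 0] satisfies [E]: morphisms
       in [Hom (c 0) (c 0)] are identities on T(<= c 0). *)
    + apply not_all_ex_not in HL. destruct HL as [U' HL].
      apply not_all_ex_not in HL. destruct HL as [c' HL].
      apply imply_to_and in HL. destruct HL as [P' HL].
      apply imply_to_and in HL. destruct HL as [E' HL].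
      apply imply_to_and in HL. destruct HL as [R' HL].
      exists U', c'. split; [exact P'|]. split; [exact E'|]. split; [exact R'|]. right.
      intros e j He Hs HE. destruct (Hred U' c' e j P' E' He Hs) as (d & F & -> & HF).
      apply HL. exists d, F. split; [exact HF|]. intros v Hv.
      apply (P_ext F); [|exact HE]. intros a La. f_equal.
      apply tle_lev_eq; [apply (Hom_tle _ _ _ _ Hv La)|].
      destruct (Nat.eq_dec (lev a) (c 0)) as [e|n].
      * apply Nat.eq_le_incl. rewrite e. apply Hv. exact e.
      * destruct Hv as (_ & Iv & _). rewrite Iv; lia.
  - apply imply_to_and in Hlet. destruct Hlet as [Ec Hn].
    assert (Huniq : forall e m, edge (c 0) e m -> e = restr 0 (fun a => a)).
    { intros e m He. apply edge_iff in He. destruct He as (m' & F & _ & HF & ->). rewrite Ec in *.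
      destruct m' as [|m'].
      - apply restr_ext. intros a La. symmetry. apply tle_lev_eq; [apply (Hom_tle _ _ _ _ HF La)|].
        destruct HF as (_ & _ & L). rewrite L; lia.
      - exfalso. apply Hn. destruct (Hom_factor 0 1 (S m') F HF) as (G & _ & HG & _); [lia|lia|]. eauto. }
    exists U, c. split; [exact HP|]. split; [reflexivity|]. split; [apply refines_refl; exact HP|].
    destruct (classic (E (restr 0 (fun a => a)))) as [HE|HE]; [left|right];
      intros e j He _; rewrite (Huniq e _ He); exact HE.
Qed.

(** * The Ellentuck theorem *)

Lemma sub_edge_refines V cV U cU e i j d : path V cV -> path U cU -> refines V cV U cU ->
  cV i = cU j -> sub_edge (cV i) e V i d ->
  exists d', sub_edge (cU j) e U j d' /\ cU (j + d') = cV (i + d).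
Proof.
  intros HV HU HR E HS.
  destruct (comp_refines V cV U cU i d HV HU HR) as (j' & d' & E1 & E2 & HC).
  assert (j' = j) as -> by (apply (path_inj U cU); [exact HU|congruence]).
  exists d'. split; [|congruence]. rewrite <- E. intros a y La Hr. apply HC; auto.
Qed.

Lemma path_cuts_unique V c c' : path V c -> path V c' -> c 0 = c' 0 -> c = c'.
Proof.
  intros H H' E. apply functional_extensionality. intros i. induction i as [|i IH]; [exact E|].
  apply (edge_target (c i) (V i)); [apply H|]. rewrite IH. apply H'.
Qed.

(** * Gluing a finite stem to a path *)

Definition scons {A : Type} (a : A) (f : nat -> A) (i : nat) : A :=
  match i with 0 => a | S i' => f i' end.

Fixpoint glue {A : Type} (x : list A) (f : nat -> A) : nat -> A :=
  match x with [] => f | a :: x' => scons a (glue x' f) end.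

Fixpoint pre {A : Type} (n : nat) (f : nat -> A) : list A :=
  match n with 0 => [] | S n' => f 0 :: pre n' (shift 1 f) end.

Lemma length_pre {A : Type} n (f : nat -> A) : length (pre n f) = n.
Proof. revert f. induction n as [|n IH]; intros f; simpl; [reflexivity|]. rewrite IH. reflexivity. Qed.

Lemma glue_app {A : Type} (x y : list A) f : glue (x ++ y) f = glue x (glue y f).
Proof. induction x as [|a x IH]; simpl; [reflexivity|]. rewrite IH. reflexivity. Qed.

Lemma scons_shift {A : Type} (f : nat -> A) : scons (f 0) (shift 1 f) = f.
Proof. apply functional_extensionality. intros [|i]; reflexivity. Qed.

Lemma glue_pre {A : Type} n (f : nat -> A) : glue (pre n f) (shift n f) = f.
Proof.
  revert f. induction n as [|n IH]; intros f; simpl; [reflexivity|].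
  transitivity (scons (f 0) (shift 1 f)); [f_equal; exact (IH (shift 1 f))|apply scons_shift].
Qed.

Lemma shift_glue {A : Type} (x : list A) f : shift (length x) (glue x f) = f.
Proof. induction x as [|a x IH]; [reflexivity|]. exact IH. Qed.

Lemma pre_glue {A : Type} (x : list A) f g n : n <= length x -> pre n (glue x f) = pre n (glue x g).
Proof.
  revert x. induction n as [|n IH]; intros [|a x] L; simpl in *; try reflexivity; [lia|].
  f_equal. apply IH. lia.
Qed.

Lemma nth_glue {A : Type} (x : list A) f d i : i < length x -> nth i x d = glue x f i.
Proof. revert i. induction x as [|a x IH]; intros [|i] L; simpl in *; try lia; auto. apply IH. lia. Qed.

Lemma nth_pre {A : Type} n (f : nat -> A) d i : i < n -> nth i (pre n f) d = f i.
Proof.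
  intros L. rewrite (nth_glue _ (shift n f)) by (rewrite length_pre; exact L).
  rewrite glue_pre. reflexivity.
Qed.

Lemma pre_nth {A : Type} (x : list A) f d : (forall i, i < length x -> nth i x d = f i) -> pre (length x) f = x.
Proof.
  intros H. apply (nth_ext _ _ d d); rewrite length_pre; [reflexivity|].
  intros i Hi. rewrite nth_pre by exact Hi. symmetry. auto.
Qed.

Lemma glue_path k x m W c : fpath k x m -> path W c -> c 0 = m ->
  exists c', path (glue x W) c' /\ c' 0 = k /\ shift (length x) c' = c.
Proof.
  intros Hx HW E. induction Hx as [k|k e m y m' He Hy IH].
  - exists c. auto.
  - destruct (IH E) as (c' & P' & E' & S'). exists (scons k c'). split; [|split; [reflexivity|exact S']].
    intros [|i]; simpl; [rewrite E'; exact He|apply P'].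
Qed.

Lemma refines_shift_left V cV U cU n : refines V cV U cU -> refines (shift n V) (shift n cV) U cU.
Proof.
  intros H l. destruct (H (n + l)) as (i & d & E1 & E2 & HS). exists i, d. unfold shift.
  rewrite Nat.add_succ_r. auto.
Qed.

Lemma fin_below_glue U cU i y j W cW : path U cU -> fin_below U cU i y j -> path W cW ->
  cW 0 = cU j -> refines W cW (shift j U) (shift j cU) ->
  exists c', path (glue y W) c' /\ c' 0 = cU i /\ shift (length y) c' = cW /\
    refines (glue y W) c' (shift i U) (shift i cU).
Proof.
  intros HU Hy HW E HR. induction Hy as [i|i d e y j He Hs Hy IH].
  - exists cW. auto.
  - destruct (IH E HR) as (c' & P' & E' & S' & R'). exists (scons (cU i) c').
    split; [|split; [reflexivity|split; [exact S'|]]].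
    + intros [|l]; simpl; [rewrite E'; exact He|apply P'].
    + intros [|l].
      * exists 0, d. unfold shift; simpl. rewrite Nat.add_0_r. split; [reflexivity|].
        split; [exact E'|]. intros a z La Hr. apply (comp_shift U i 0 d a z).
        rewrite Nat.add_0_r. apply Hs; auto.
      * destruct (R' l) as (i' & d' & E1 & E2 & HS). exists (d + i'), d'. unfold shift in *. simpl.
        split; [rewrite E1; f_equal; lia|]. split; [rewrite E2; f_equal; lia|].
        intros a z La Hr. specialize (HS a z La Hr).
        apply (comp_shift U (i + d) i' d' a z) in HS. apply (comp_shift U i (d + i') d' a z).
        rewrite Nat.add_assoc. exact HS.
Qed.

Lemma pre_fin_below V cV U cU n i : path V cV -> path U cU -> refines V cV U cU -> cV 0 = cU i ->
  exists j, fin_below U cU i (pre n V) j /\ cV n = cU j.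
Proof.
  revert V cV i. induction n as [|n IH]; intros V cV i HV HU HR E; simpl.
  - exists i. split; [constructor|exact E].
  - destruct (HR 0) as (i' & d & E1 & E2 & HS).
    assert (i' = i) as -> by (apply (path_inj U cU); [exact HU|congruence]).
    destruct (IH (shift 1 V) (shift 1 cV) (i + d)) as (j & Hj & Ej); auto.
    + apply path_shift, HV.
    + apply refines_shift_left, HR.
    + exists j. split; [|exact Ej]. apply (fb_cons U cU i d); [| |exact Hj].
      * rewrite <- E, <- E2. apply HV.
      * rewrite <- E. exact HS.
Qed.

Lemma fin_below_snoc U c i y j d e : fin_below U c i y j -> edge (c j) e (c (j + d)) ->
  sub_edge (c j) e U j d -> fin_below U c i (y ++ [e]) (j + d).
Proof.
  induction 1 as [i|i d' e' y j He Hs Hy IH]; intros H1 H2; simpl.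
  - apply (fb_cons U c i d); [exact H1|exact H2|constructor].
  - apply (fb_cons U c i d'); auto.
Qed.

(** * Accept-reject forcing *)

Section Forcing.
Variable X : @rset D.

(** [U] is only the tree above the stem: it starts at the cut [c 0], where [x] is meant to end, and
    it does not contain [x]. *)
Definition accepts (x : list approx) (U : nat -> approx) (c : nat -> nat) : Prop :=
  forall W cW, path W cW -> cW 0 = c 0 -> refines W cW U c -> X (glue x W).

Definition rejects (x : list approx) (U : nat -> approx) (c : nat -> nat) : Prop :=
  forall U' c', path U' c' -> c' 0 = c 0 -> refines U' c' U c -> ~ accepts x U' c'.

Lemma accepts_mono x U c U' c' : path U c -> path U' c' -> c' 0 = c 0 -> refines U' c' U c ->
  accepts x U c -> accepts x U' c'.
Proof.
  intros P P' E R H W cW PW EW RW. apply (H W cW PW); [congruence|].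
  exact (refines_trans _ _ _ _ _ _ P' P RW R).
Qed.

Lemma rejects_mono x U c U' c' : path U c -> path U' c' -> c' 0 = c 0 -> refines U' c' U c ->
  rejects x U c -> rejects x U' c'.
Proof.
  intros P P' E R H W cW PW EW RW. apply (H W cW PW); [congruence|].
  exact (refines_trans _ _ _ _ _ _ P' P RW R).
Qed.

Lemma accepts_not_rejects x U c : path U c -> accepts x U c -> ~ rejects x U c.
Proof. intros P H H'. exact (H' U c P eq_refl (refines_refl _ _ P) H). Qed.

Lemma decides_ex x U c : path U c -> exists U' c', path U' c' /\ c' 0 = c 0 /\ refines U' c' U c /\
  (accepts x U' c' \/ rejects x U' c').
Proof.
  intros P. destruct (classic (rejects x U c)) as [H|H].
  - exists U, c. split; [exact P|]. split; [reflexivity|]. split; [apply refines_refl; exact P|auto].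
  - apply not_all_ex_not in H. destruct H as [U' H].
    apply not_all_ex_not in H. destruct H as [c' H].
    apply imply_to_and in H. destruct H as [P' H].
    apply imply_to_and in H. destruct H as [E' H].
    apply imply_to_and in H. destruct H as [R' H].
    apply NNPP in H. exists U', c'. auto.
Qed.

Definition rejects_next (x : list approx) (U : nat -> approx) (c : nat -> nat) : Prop :=
  forall e j, edge (c 0) e (c j) -> sub_edge (c 0) e U 0 j -> rejects (x ++ [e]) (shift j U) (shift j c).

Lemma rejects_next_mono x U c U' c' : path U c -> path U' c' -> c' 0 = c 0 -> refines U' c' U c ->
  rejects_next x U c -> rejects_next x U' c'.
Proof.
  intros P P' E R H e j He Hs.
  destruct (sub_edge_refines U' c' U c e 0 0 j P' P R E Hs) as (j1 & Hs1 & Ej). simpl in Ej.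
  apply (rejects_mono _ (shift j1 U) (shift j1 c)).
  - apply path_shift, P.
  - apply path_shift, P'.
  - unfold shift. rewrite !Nat.add_0_r. auto.
  - apply refines_shift; auto.
  - apply H; [|exact Hs1]. rewrite Ej, <- E. exact He.
Qed.

(** After fusion every finite extension of [x] is decided. The pigeonhole principle then makes all
    one-edge extensions accepted, in which case [x] is accepted too, or all rejected. *)
Lemma accepts_or_rejects_next x U c : path U c ->
  exists U' c', path U' c' /\ c' 0 = c 0 /\ refines U' c' U c /\
    (accepts x U' c' \/ rejects_next x U' c').
Proof.
  intros HP.
  destruct (fusion (fun y U1 c1 => accepts (x ++ y) U1 c1 \/ rejects (x ++ y) U1 c1) U c HP)
    as (U1 & c1 & P1 & E1 & R1 & H1).
  - intros y V cV W cW PV PW E R [H|H]; [left|right].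
    + exact (accepts_mono _ V cV W cW PV PW E R H).
    + exact (rejects_mono _ V cV W cW PV PW E R H).
  - intros y j V cV PV _ _ _. apply decides_ex. exact PV.
  - destruct (pigeonhole U1 c1 (fun e => exists j, edge (c1 0) e (c1 j) /\ sub_edge (c1 0) e U1 0 j /\
        accepts (x ++ [e]) (shift j U1) (shift j c1)) P1) as (U2 & c2 & P2 & E2 & R2 & H2).
    exists U2, c2. split; [exact P2|]. split; [congruence|].
    split; [exact (refines_trans _ _ _ _ _ _ P1 HP R2 R1)|].
    rewrite <- E2 in H2. destruct H2 as [H2|H2]; [left|right].
    + intros W cW PW EW RW.
      destruct (RW 0) as (i & d & F1 & F2 & HS).
      assert (i = 0) as -> by (apply (path_inj U2 c2); [exact P2|congruence]). simpl in F2.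
      destruct (H2 (W 0) d) as (j & He & Hs & Ha).
      * rewrite <- EW, <- F2. apply PW.
      * rewrite <- EW. exact HS.
      * specialize (Ha (shift 1 W) (shift 1 cW)). rewrite glue_app in Ha. simpl in Ha.
        rewrite scons_shift in Ha.
        assert (Ecut : cW 1 = c1 j).
        { rewrite <- EW in He. exact (edge_target _ _ _ _ (PW 0) He). }
        apply Ha.
        -- apply path_shift, PW.
        -- unfold shift. rewrite !Nat.add_0_r. exact Ecut.
        -- apply refines_shift; auto. exact (refines_trans _ _ _ _ _ _ P2 P1 RW R2).
    + intros e j He Hs.
      destruct (sub_edge_refines U2 c2 U1 c1 e 0 0 j P2 P1 R2 E2 Hs) as (j1 & Hs1 & Ej). simpl in Ej.
      assert (He1 : edge (c1 0) e (c1 j1)) by (rewrite Ej, <- E2; exact He).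
      apply (rejects_mono _ (shift j1 U1) (shift j1 c1)).
      * apply path_shift, P1.
      * apply path_shift, P2.
      * unfold shift. rewrite !Nat.add_0_r. auto.
      * apply refines_shift; auto.
      * destruct (H1 [e] j1) as [Ha|Hr]; [|exfalso|exact Hr].
        -- apply (fb_cons U1 c1 0 j1); [exact He1|exact Hs1|constructor].
        -- apply (H2 e j He Hs). exists j1. rewrite E2. auto.
Qed.

(** Fusion arranges that every stem which is not accepted is rejected together with its one-edge
    extensions; rejection then spreads along all finite paths. *)
Lemma accepts_or_rejects_all x U c : path U c ->
  exists U' c', path U' c' /\ c' 0 = c 0 /\ refines U' c' U c /\
    (accepts x U' c' \/
     forall y j, fin_below U' c' 0 y j -> rejects (x ++ y) (shift j U') (shift j c')).
Proof.
  intros HP.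
  destruct (fusion (fun y U1 c1 => accepts (x ++ y) U1 c1 \/
      (rejects (x ++ y) U1 c1 /\ rejects_next (x ++ y) U1 c1)) U c HP)
    as (U1 & c1 & P1 & E1 & R1 & H1).
  - intros y V cV W cW PV PW E R [H|[H H']]; [left|right; split].
    + exact (accepts_mono _ V cV W cW PV PW E R H).
    + exact (rejects_mono _ V cV W cW PV PW E R H).
    + exact (rejects_next_mono _ V cV W cW PV PW E R H').
  - intros y j V cV PV _ _ _.
    destruct (decides_ex (x ++ y) V cV PV) as (V1 & cV1 & PV1 & EV1 & RV1 & [H|H]).
    { exists V1, cV1. auto. }
    destruct (accepts_or_rejects_next (x ++ y) V1 cV1 PV1) as (V2 & cV2 & PV2 & EV2 & RV2 & H2).
    exists V2, cV2. split; [exact PV2|]. split; [congruence|].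
    split; [exact (refines_trans _ _ _ _ _ _ PV1 PV RV2 RV1)|].
    assert (Hr : rejects (x ++ y) V2 cV2) by exact (rejects_mono _ _ _ _ _ PV1 PV2 EV2 RV2 H).
    destruct H2 as [H2|H2]; [left|right]; auto.
  - exists U1, c1. split; [exact P1|]. split; [exact E1|]. split; [exact R1|].
    destruct (H1 [] 0 ltac:(constructor)) as [Ha|[Hr _]]; rewrite app_nil_r in *; [left; exact Ha|right].
    (* Finite paths are built from the front, so the edges already passed are collected in [y0]. *)
    assert (Hind : forall i y j, fin_below U1 c1 i y j -> forall y0, fin_below U1 c1 0 y0 i ->
              rejects (x ++ y0) (shift i U1) (shift i c1) ->
              rejects (x ++ y0 ++ y) (shift j U1) (shift j c1)).
    { induction 1 as [i|i d e y j He Hs Hy IH]; intros y0 Hy0 H0.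
      - rewrite app_nil_r. exact H0.
      - replace (y0 ++ e :: y) with ((y0 ++ [e]) ++ y) by (rewrite <- app_assoc; reflexivity).
        apply IH; [apply fin_below_snoc; auto|].
        destruct (H1 y0 i Hy0) as [Ha|[_ Hn]].
        { exfalso. exact (accepts_not_rejects _ _ _ (path_shift _ _ i P1) Ha H0). }
        specialize (Hn e d). rewrite !shift_shift, <- app_assoc in Hn. apply Hn.
        + unfold shift. rewrite Nat.add_0_r. exact He.
        + unfold shift at 1. rewrite Nat.add_0_r. intros a z La Hz.
          apply (comp_shift U1 i 0 d a z). rewrite Nat.add_0_r. apply Hs; auto. }
    intros y j Hy. apply (Hind 0 y j Hy []); [constructor|]. rewrite app_nil_r. exact Hr.
Qed.

End Forcing.

Lemma glue_refines k x m W cW Z cZ : fpath k x m -> path W cW -> path Z cZ -> cW 0 = m -> cZ 0 = m ->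
  refines Z cZ W cW ->
  exists c1 c2, path (glue x Z) c1 /\ path (glue x W) c2 /\ c1 0 = k /\ c2 0 = k /\
    refines (glue x Z) c1 (glue x W) c2.
Proof.
  intros Hx PW PZ EW EZ R.
  destruct (glue_path k x m W cW Hx PW EW) as (c2 & P2 & E2 & S2).
  destruct (pre_fin_below _ _ _ _ (length x) 0 P2 P2 (refines_refl _ _ P2) eq_refl) as (j & Hj & Ej).
  assert (j = length x) as -> by (symmetry; apply (path_inj _ _ _ _ P2 Ej)).
  rewrite (pre_nth x (glue x W) noapprox) in Hj by (intros i Hi; apply nth_glue; exact Hi).
  destruct (fin_below_glue _ _ _ _ _ Z cZ P2 Hj PZ) as (c1 & P1 & E1 & _ & R1).
  - rewrite EZ, <- EW, <- S2. unfold shift. f_equal. lia.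
  - rewrite shift_glue, S2. exact R.
  - exists c1, c2. split; [exact P1|]. split; [exact P2|]. split; [congruence|]. split; [exact E2|]. exact R1.
Qed.

(** * Open sets, null sets and their countable unions *)

Definition locally_basic (O : @rset D) : Prop :=
  forall V, O V -> exists c n, path V c /\ c 0 = 0 /\
    forall W cW, path W cW -> cW 0 = 0 -> refines W cW V c -> pre n W = pre n V -> O W.

(** If all stems are rejected, no [x]-extension [W] is in [O]: a neighbourhood of it inside [O]
    would make some initial segment accepted by the corresponding tail. *)
Lemma locally_basic_ramsey (O : rset) x k U c : locally_basic O -> fpath 0 x k -> path U c -> c 0 = k ->
  exists U' c', path U' c' /\ c' 0 = k /\ refines U' c' U c /\
    (accepts O x U' c' \/ accepts (fun V => ~ O V) x U' c').
Proof.
  intros HO Hx HP Ek.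
  destruct (accepts_or_rejects_all O x U c HP) as (U' & c' & P' & E' & R' & H').
  exists U', c'. split; [exact P'|]. split; [congruence|]. split; [exact R'|].
  destruct H' as [H'|H']; [left; exact H'|right]. intros W cW PW EW RW HW.
  destruct (HO _ HW) as (cV & n & PV & EV & Hn).
  destruct (pre_fin_below W cW U' c' n 0 PW P' RW EW) as (j & Hj & Ej).
  apply (H' _ _ Hj (shift n W) (shift n cW)).
  - apply path_shift, PW.
  - unfold shift. rewrite !Nat.add_0_r. exact Ej.
  - apply refines_shift; auto.
  - intros Z cZ PZ EZ RZ.
    assert (Hxy : fpath 0 (x ++ pre n W) (cW n)).
    { eapply fpath_app; [exact Hx|]. replace k with (c' 0) by congruence. rewrite Ej.
      apply (fin_below_fpath _ _ _ _ _ Hj). }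
    assert (Esh : shift n cW 0 = cW n) by (unfold shift; f_equal; lia).
    destruct (glue_refines _ _ _ _ _ _ _ Hxy (path_shift _ _ n PW) PZ Esh ltac:(congruence) RZ)
      as (c1 & c2 & P1 & P2 & E1 & E2 & R12).
    assert (EqV : glue (x ++ pre n W) (shift n W) = glue x W) by (rewrite glue_app, glue_pre; reflexivity).
    rewrite EqV in P2, R12.
    rewrite (path_cuts_unique _ _ _ P2 PV) in R12 by congruence.
    apply (Hn _ c1 P1 E1 R12).
    rewrite <- EqV. apply pre_glue. rewrite length_app, length_pre. lia.
Qed.

Definition null (N : @rset D) : Prop := forall x k U c, fpath 0 x k -> path U c -> c 0 = k ->
  exists U' c', path U' c' /\ c' 0 = k /\ refines U' c' U c /\ accepts (fun V => ~ N V) x U' c'.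

(** At a stem of length [n], fusion takes care of [Ns 0], ..., [Ns n]. A member of [Ns i] is then
    excluded by its initial segment of length [i] after [x]. *)
Lemma null_union (Ns : nat -> rset) : (forall i, null (Ns i)) -> null (fun V => exists i, Ns i V).
Proof.
  intros HN x k U c Hx HP Ek.
  destruct (fusion (fun y U1 c1 => forall i, i <= length y ->
      accepts (fun V => ~ Ns i V) (x ++ y) U1 c1) U c HP) as (U' & c' & P' & E' & R' & H').
  - intros y U1 c1 U2 c2 P1 P2 E R H i Hi. exact (accepts_mono _ _ _ _ _ _ P1 P2 E R (H i Hi)).
  - intros y j U1 c1 P1 E1 Hy _.
    destruct (finite_shrink nat (seq 0 (S (length y)))
      (fun i V cV => accepts (fun V => ~ Ns i V) (x ++ y) V cV) U1 c1 P1) as (U2 & c2 & P2 & E2 & R2 & H2).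
    + intros i V cV W cW PV PW E R H. exact (accepts_mono _ _ _ _ _ _ PV PW E R H).
    + intros i V cV _ PV EV _. rewrite Ek in Hy.
      destruct (HN i (x ++ y) (c j) V cV) as (W & cW & PW & EW & RW & HW).
      * eapply fpath_app; eauto.
      * exact PV.
      * congruence.
      * exists W, cW. split; [exact PW|]. split; [congruence|]. split; [exact RW|exact HW].
    + exists U2, c2. split; [exact P2|]. split; [exact E2|]. split; [exact R2|].
      intros i Hi. apply H2. apply in_seq. lia.
  - exists U', c'. split; [exact P'|]. split; [congruence|]. split; [exact R'|].
    intros W cW PW EW RW (i & Hi).
    destruct (pre_fin_below W cW U' c' i 0 PW P' RW EW) as (j & Hj & Ej).
    apply (H' _ _ Hj i ltac:(rewrite length_pre; lia) (shift i W) (shift i cW)).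
    + apply path_shift, PW.
    + unfold shift. rewrite !Nat.add_0_r. exact Ej.
    + apply refines_shift; auto.
    + rewrite glue_app, glue_pre. exact Hi.
Qed.

(** * Translation between paths and fat subtrees *)

Lemma is_cut_path V c : is_cut M allnat V c <-> c 0 = 0 /\ path V c.
Proof.
  split; intros [E H]; (split; [exact E|]).
  - intros i. apply (H i I).
  - intros i _. apply H.
Qed.

Lemma lift_step_iff U c (X : node D -> Prop) l m y : edge (c l) (U l) m -> (forall a, X a -> lev a = c l) ->
  (lift_step M U c X l y <-> exists a, X a /\ rel (U l) a y).
Proof.
  intros He HX. apply edge_iff in He. destruct He as (m' & F & _ & HF & EU). split.
  - intros (G & (MG & EG & SG) & a & b & Xa & Hab & ->). exists a. split; [exact Xa|].
    apply imm_succ_iff in Hab. destruct Hab as [Tab Lb]. pose proof (HX a Xa) as La.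
    destruct (Sf_ex a b Tab Lb) as (p & s & E).
    assert (EF : forall a, lev a <= c l -> G a = F a).
    { intros a' La'. specialize (EG a' La'). rewrite EU, restr_le in EG by exact La'. congruence. }
    destruct (Hom_Sf (c l) m' G a b p s) as (b' & E' & Tb').
    { split; [exact MG|]. split; intros a' La'; rewrite EF by lia; apply HF; exact La'. }
    { lia. }
    { exact E. }
    (* All levels from that of [G a] on are attained by [G], so monotonicity leaves only the very
       next level for [G b]. *)
    assert (b' = G b) as <-.
    { apply tle_lev_eq; [exact Tb'|]. rewrite (Sf_lev _ _ _ _ E').
      destruct (SG a (S (lev (G a))) La ltac:(lia)) as (b1 & L1).
      destruct (le_lt_dec (lev b) (lev b1)) as [h|h].
      - pose proof (M_lev_mono G MG b b1 h). lia.
      - pose proof (M_lev_mono G MG b1 a ltac:(lia)). lia. }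
    exists p, s, b, (G a). split; [exact E|]. split; [apply EG; lia|exact E'].
  - intros (a & Xa & (p & s & x & a' & E1 & E2 & E3)). pose proof (HX a Xa) as La.
    destruct (canonical_extension (c l) m' F (proj1 HF)) as (G & MG & EG & LG); [apply HF|].
    exists G. split.
    + split; [exact MG|]. split.
      * intros b Lb. rewrite EU, restr_le by exact Lb. rewrite EG by exact Lb. reflexivity.
      * intros b j Lb Lj. pose proof (LG 0 b ltac:(lia)).
        destruct (level_nonempty (c l + (j - m'))) as [b1 L1].
        exists b1. rewrite (LG (j - m') b1 L1). lia.
    + exists a, x. split; [exact Xa|]. split.
      * apply imm_succ_iff. split; [eapply Sf_tle; eauto|eapply Sf_lev; eauto].
      * assert (HG : sharp (c l) m' G).
        { split; [split; [exact MG|split]|].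
          - intros b Lb. rewrite EG by lia. apply HF. exact Lb.
          - intros b Lb. rewrite EG by lia. apply HF. exact Lb.
          - intros b Lb. rewrite (LG 1); lia. }
        pose proof (sharp_Sf _ _ _ _ _ _ _ HG La E1) as E4.
        rewrite EU, restr_le in E2 by lia. injection E2 as <-. rewrite EG in E4 by lia. congruence.
Qed.

Lemma Lift_iff U c (X : node D -> Prop) l d y : path U c -> (forall a, X a -> lev a = c l) ->
  (Lift M U c X l d y <-> exists a, X a /\ comp U l d a y).
Proof.
  intros HP. revert X l. induction d as [|d IH]; intros X l HX; simpl.
  - split; [intros H; eauto|intros (a & H & <-); exact H].
  - rewrite IH.
    + split.
      * intros (b & Hb & Hc). apply (lift_step_iff _ _ _ _ _ _ (HP l) HX) in Hb.
        destruct Hb as (a & Xa & Hr). eauto.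
      * intros (a & Xa & b & Hr & Hc). exists b. split; [|exact Hc].
        apply (lift_step_iff _ _ _ _ _ _ (HP l) HX). eauto.
    + intros b Hb. apply (lift_step_iff _ _ _ _ _ _ (HP l) HX) in Hb.
      destruct Hb as (a & Xa & Hr). apply (rel_lev _ _ _ _ _ (HP l) (HX a Xa) Hr).
Qed.

(** [V'] may be a finite sequence that agrees with the path [V] only below its height; this covers
    stems as well. *)
Lemma refines_fat_le (inV : nat -> Prop) V' V cV U cU : path V cV -> cV 0 = 0 -> path U cU -> cU 0 = 0 ->
  refines V cV U cU -> (forall l, inV l -> V' l = V l) -> fat_le M inV V' U.
Proof.
  intros PV EV PU EU HR HV'.
  destruct (functional_choice_on nat nat (fun l i => cV l = cU i)) as [phi Hphi].
  { intros l. eapply refines_cut; eauto. }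
  exists cV, cU, phi. split; [|split; [apply is_cut_path; auto|]].
  - split; [exact EV|]. intros l Hl. rewrite (HV' l Hl). apply PV.
  - intros l Hl. destruct (HR l) as (i & d & E1 & E2 & HS).
    assert (phi l = i) as Ei by (apply (path_inj U cU); [exact PU|congruence]).
    assert (phi (S l) = i + d) as Ed by (apply (path_inj U cU); [exact PU|congruence]).
    split; [apply Hphi|]. split; [lia|]. intros y Hy. simpl in Hy.
    assert (Hy' : exists a, levset (cV l) a /\ rel (V' l) a y).
    { apply (lift_step_iff V' cV _ l (cV (S l))); auto. rewrite (HV' l Hl). apply PV. }
    destruct Hy' as (a & Ha & Hr). rewrite (HV' l Hl) in Hr.
    apply (Lift_iff U cU); [exact PU|auto|]. exists a. rewrite <- Hphi. split; [exact Ha|].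
    rewrite Ed, Ei. replace (i + d - i) with d by lia. apply HS; auto.
Qed.

(** The order compares lifts as sets, but this amounts to a pointwise comparison: the source of [y]
    in either lift is its ancestor on the level of the cut. *)
Lemma fat_le_refines V U : fat_le M allnat V U ->
  exists cV cU, path V cV /\ cV 0 = 0 /\ path U cU /\ cU 0 = 0 /\ refines V cV U cU.
Proof.
  intros (cV & cU & phi & HV & HU & H). apply is_cut_path in HV, HU.
  destruct HV as [EV PV], HU as [EU PU].
  exists cV, cU. split; [exact PV|]. split; [exact EV|]. split; [exact PU|]. split; [exact EU|].
  intros l. destruct (H l I) as (E1 & L1 & HS). destruct (H (S l) I) as (E2 & _ & _).
  exists (phi l), (phi (S l) - phi l). split; [exact E1|].
  split; [rewrite E2; f_equal; lia|]. intros a y La Hr.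
  assert (Hy : Lift M V cV (levset (cV l)) l 1 y).
  { apply (lift_step_iff V cV _ l _ y (PV l)); [auto|]. exists a. auto. }
  apply HS in Hy. apply (Lift_iff U cU) in Hy; [|exact PU|auto].
  destruct Hy as (a' & La' & Hc). unfold levset in La'.
  replace a with a'; [exact Hc|].
  apply (tle_below_eq a' a y); [|eapply rel_lev; [apply PV|exact La|exact Hr]|congruence].
  apply (comp_lev _ _ _ _ _ _ PU La' Hc).
Qed.

Lemma path_Rsp V c : path V c -> c 0 = 0 -> Rsp M V.
Proof. intros H E. exists c. apply is_cut_path. auto. Qed.

Lemma fpath_ARsp x k U c : fpath 0 x k -> path U c -> c 0 = k ->
  exists cx, is_cut M (below_len x) (seq_of x) cx /\ cx (length x) = k.
Proof.
  intros Hx HP E. destruct (glue_path 0 x k U c Hx HP E) as (c' & P' & E' & S').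
  exists c'. split.
  - split; [exact E'|]. intros l Hl. unfold seq_of. rewrite (nth_glue x U) by exact Hl. apply P'.
  - rewrite <- E, <- S'. unfold shift. f_equal. lia.
Qed.

Lemma prefix_glue (x : list (@approx D)) V : (forall i, i < length x -> nth i x noapprox = V i) ->
  V = glue x (shift (length x) V).
Proof.
  intros H. rewrite <- (glue_pre (length x) V) at 1. rewrite (pre_nth x V noapprox H). reflexivity.
Qed.

Lemma fpath_pre V c n : path V c -> fpath (c 0) (pre n V) (c n).
Proof.
  intros H. destruct (pre_fin_below V c V c n 0 H H (refines_refl _ _ H) eq_refl) as (j & Hj & Ej).
  rewrite Ej. apply (fin_below_fpath _ _ _ _ _ Hj).
Qed.

Lemma fpath_target k x m m' : fpath k x m -> fpath k x m' -> m = m'.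
Proof.
  intros H. revert m'. induction H as [k|k e m y m1 He Hy IH]; intros m' H'.
  - inversion H'. reflexivity.
  - inversion H' as [|? ? m2 ? ? He2 Hy2]; subst. apply IH.
    rewrite (edge_target _ _ _ _ He He2). exact Hy2.
Qed.

(** Both stems end at the same cut [k], so the tail of [V] above [x] refines the tail above [z],
    which is [U]. *)
Lemma basic_glue x z k U c V : fpath 0 x k -> fpath 0 z k -> path U c -> c 0 = k ->
  basic M x (glue z U) V ->
  exists W cW, path W cW /\ cW 0 = k /\ refines W cW U c /\ V = glue x W.
Proof.
  intros Hx Hz PU EU (_ & HV & Hpre).
  destruct (fat_le_refines _ _ HV) as (cV & cG & PV & EV & PG & EG & R).
  destruct (glue_path 0 z k U c Hz PU EU) as (c' & P' & E' & S').
  rewrite (path_cuts_unique _ _ _ PG P') in R by congruence.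
  assert (Ex : cV (length x) = k).
  { pose proof (fpath_pre V cV (length x) PV) as H.
    rewrite (pre_nth x V noapprox Hpre), EV in H. eapply fpath_target; eauto. }
  exists (shift (length x) V), (shift (length x) cV).
  split; [apply path_shift, PV|].
  split; [unfold shift; rewrite Nat.add_0_r; exact Ex|].
  split; [|apply prefix_glue; exact Hpre].
  rewrite <- (shift_glue z U), <- S'. apply refines_shift; auto.
  rewrite Ex, <- EU, <- S'. unfold shift. f_equal. lia.
Qed.

Lemma basic_intro x V c k W cW : fpath 0 x k -> path W cW -> cW 0 = k ->
  path V c -> c 0 = 0 -> (forall c1, path (glue x W) c1 -> c1 0 = 0 -> refines (glue x W) c1 V c) ->
  basic M x V (glue x W).
Proof.
  intros Hx PW EW PV EV H. destruct (glue_path 0 x k W cW Hx PW EW) as (c1 & P1 & E1 & _).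
  split; [eapply path_Rsp; eauto|]. split.
  - apply (refines_fat_le _ _ (glue x W) c1 V c); auto.
  - intros i Hi. apply nth_glue. exact Hi.
Qed.

Lemma basic_fin_below x U V : basic M x U V ->
  exists cU n, path U cU /\ cU 0 = 0 /\ fin_below U cU 0 x n.
Proof.
  intros (_ & HV & Hpre).
  destruct (fat_le_refines _ _ HV) as (cV & cU & PV & EV & PU & EU & R).
  destruct (pre_fin_below V cV U cU (length x) 0 PV PU R ltac:(congruence)) as (n & Hn & _).
  rewrite (pre_nth x V noapprox Hpre) in Hn. eauto 6.
Qed.

Lemma cone_glue x U cU n U' c' : path U cU -> cU 0 = 0 -> fin_below U cU 0 x n ->
  path U' c' -> c' 0 = cU n -> refines U' c' (shift n U) (shift n cU) ->
  in_depth_cone M x U (glue (pre n U) U').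
Proof.
  intros PU EU Hx P' E' R'.
  pose proof (fin_below_fpath _ _ _ _ _ Hx) as Fx. rewrite EU in Fx.
  destruct (pre_fin_below U cU U cU n 0 PU PU (refines_refl _ _ PU) eq_refl) as (j & Hj & Ej).
  assert (j = n) as -> by (symmetry; apply (path_inj _ _ _ _ PU Ej)).
  destruct (fin_below_glue U cU 0 _ n U' c' PU Hj P' E' R') as (c1 & P1 & E1 & _ & R1).
  rewrite EU in E1.
  split; [eapply path_Rsp; eauto|].
  split; [apply (refines_fat_le _ _ (glue (pre n U) U') c1 U cU); auto|].
  split.
  - intros _. destruct (fpath_ARsp x (cU n) U' c' Fx P' E') as (cx & Hcx & Ecx).
    exists n, cx, cU. split; [exact Hcx|]. split; [apply is_cut_path; auto|].
    split; [congruence|]. intros i Hi.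
    rewrite <- (nth_glue _ _ noapprox) by (rewrite length_pre; exact Hi).
    apply nth_pre. exact Hi.
  (* [x] does lie below [U], as an initial segment of [glue x U']. *)
  - intros Hn. exfalso. apply Hn.
    destruct (fin_below_glue U cU 0 x n U' c' PU Hx P' E' R') as (c2 & P2 & E2 & _ & R2).
    rewrite EU in E2. apply (refines_fat_le _ _ (glue x U') c2 U cU); auto.
    intros l Hl. apply nth_glue. exact Hl.
Qed.

Lemma Eopen_locally_basic O : Eopen M O -> locally_basic O.
Proof.
  intros [HO Hb] V OV. destruct (HO V OV) as [c Hc]. apply is_cut_path in Hc. destruct Hc as [E P].
  destruct (Hb V OV) as (l & _ & [_ HV] & Hsub).
  (* Agreement up to the longest stem settles all stems of the finite intersection. *)
  exists c, (list_max (map (fun p => length (fst p)) l)). split; [exact P|]. split; [exact E|].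
  intros W cW PW EW RW Epre. apply Hsub. split; [eapply path_Rsp; eauto|].
  rewrite Forall_forall in HV |- *. intros [y Uy] Hin. destruct (HV _ Hin) as (_ & HVy & Hpre). simpl in *.
  split; [eapply path_Rsp; eauto|]. split.
  - destruct (fat_le_refines _ _ HVy) as (c1 & cy & P1 & E1 & Py & Ey & R).
    rewrite (path_cuts_unique _ _ _ P1 P) in R by congruence.
    apply (refines_fat_le _ _ W cW Uy cy); auto.
    exact (refines_trans _ _ _ _ _ _ P Py RW R).
  - intros i Hi. rewrite (Hpre i Hi).
    assert (Hlen : length y <= list_max (map (fun p : list approx * (nat -> @approx D) => length (fst p)) l)).
    { pose proof (proj1 (list_max_le (map (fun p : list approx * (nat -> @approx D) => length (fst p)) l) _) (le_n _)) as H.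
      rewrite Forall_forall in H. apply H. apply in_map_iff. exists (y, Uy). auto. }
    rewrite <- (nth_pre _ V noapprox i (Nat.lt_le_trans _ _ _ Hi Hlen)), <- Epre.
    apply nth_pre. lia.
Qed.

(** The complement of the closure is open, hence decided above [x]. If it contains all extensions,
    they avoid [N]; if it contains none, a basic set lies inside the closure, against nowhere
    density. *)
Lemma nowhere_dense_null N : nowhere_dense M N -> null N.
Proof.
  intros [HNR HN] x k U c Hx HP Ek.
  destruct (locally_basic_ramsey (fun V => Rsp M V /\ ~ closure M N V) x k U c) as (U' & c' & P' & E' & R' & H');
    auto.
  - intros V [HV Hcl].
    assert (Hex : exists O, Eopen M O /\ O V /\ forall W, O W -> ~ N W).
    { apply NNPP. intros Hno. apply Hcl. split; [exact HV|]. intros O HO OV.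
      apply NNPP. intros Hm. apply Hno. exists O. split; [exact HO|]. split; [exact OV|].
      intros W OW NW. apply Hm. eauto. }
    destruct Hex as (O & HO & OV & Hdis).
    destruct (Eopen_locally_basic O HO V OV) as (cV & n & PV & EV & Hn).
    exists cV, n. split; [exact PV|]. split; [exact EV|].
    intros W cW PW EW RW Epre. split; [eapply path_Rsp; eauto|].
    intros [_ Hc]. destruct (Hc O HO (Hn W cW PW EW RW Epre)) as (Z & OZ & NZ). exact (Hdis Z OZ NZ).
  - exists U', c'. split; [exact P'|]. split; [exact E'|]. split; [exact R'|].
    destruct H' as [H'|H']; intros W cW PW EW RW HNW.
    + destruct (H' W cW PW EW RW) as [HR Hcl]. apply Hcl. split; [exact HR|]. intros O _ OV. eauto.
    + clear W cW PW EW RW HNW.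
      destruct (glue_path 0 x k U' c' Hx P' E') as (c1 & P1 & E1 & S1).
      apply (HN (glue x U')). exists (basic M x (glue x U')). split; [|split].
      * split; [intros V HV; apply HV|]. intros V HV. exists [(x, glue x U')]. split; [|split].
        -- constructor; [|constructor]. split; [|eapply path_Rsp; eauto].
           destruct (fpath_ARsp x k U' c' Hx P' E') as (cx & Hcx & _). exists cx. exact Hcx.
        -- split; [apply HV|]. constructor; [exact HV|constructor].
        -- intros W [_ HW]. inversion HW; auto.
      * intros V HV. destruct (basic_glue x x k U' c' V Hx Hx P' E' HV) as (W & cW & PW & EW & RW & ->).
        apply NNPP. intros Hcl. apply (H' W cW PW); [congruence|exact RW|]. split; [|exact Hcl].
        apply HV.
      * apply (basic_intro x _ c1 k U' c'); auto. intros c2 P2 E2.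
        rewrite (path_cuts_unique _ _ _ P2 P1) by congruence. apply refines_refl. exact P1.
Qed.

Lemma meager_null A : meager M A -> null A.
Proof.
  intros [_ (Ns & HNs & Hcov)] x k U c Hx HP Ek.
  destruct (null_union Ns (fun i => nowhere_dense_null _ (HNs i)) x k U c Hx HP Ek)
    as (U' & c' & P' & E' & R' & H').
  exists U', c'. split; [exact P'|]. split; [exact E'|]. split; [exact R'|].
  intros W cW PW EW RW HA. exact (H' W cW PW EW RW (Hcov _ HA)).
Qed.

End Tree.

Theorem mainTheorem9 (D : Sdata) (M : (node D -> node D) -> Prop)
  (HSM : is_SMtree M) :
  (forall X : rset, sub X (Rsp M) -> has_Baire M X -> Ramsey M X) /\
  (forall X : rset, sub X (Rsp M) -> meager M X -> Ramsey_null M X).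
Proof.
  split.
  - intros X _ (_ & O & HO & HM) x U _ _ (V & HV).
    destruct (basic_fin_below HSM x U V HV) as (cU & n & PU & EU & Hx).
    pose proof (fin_below_fpath _ _ _ _ _ Hx) as Fx. rewrite EU in Fx.
    assert (Et : shift n cU 0 = cU n) by (unfold shift; f_equal; lia).
    (* First [O] is decided, then the set where [X] and [O] differ is avoided by a further
       refinement, so the decision passes to [X]. *)
    destruct (locally_basic_ramsey HSM O x (cU n) (shift n U) (shift n cU)
      (Eopen_locally_basic HSM O HO) Fx (path_shift _ _ _ PU) Et) as (U1 & c1 & P1 & E1 & R1 & H1).
    destruct (meager_null HSM _ HM x (cU n) U1 c1 Fx P1 E1) as (U2 & c2 & P2 & E2 & R2 & H2).
    exists (glue (pre n U) U2). split.
    + apply (cone_glue HSM x U cU n U2 c2); auto.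
      exact (refines_trans HSM _ _ _ _ _ _ P1 (path_shift _ _ _ PU) R2 R1).
    + assert (Fn : fpath (M := M) 0 (pre n U) (cU n)).
      { pose proof (fpath_pre HSM U cU n PU) as F. rewrite EU in F. exact F. }
      destruct H1 as [H1|H1]; [left|right]; intros W HW;
        destruct (basic_glue HSM x (pre n U) (cU n) U2 c2 W Fx Fn P2 E2 HW) as (Z & cZ & PZ & EZ & RZ & ->);
        pose proof (H2 Z cZ PZ ltac:(congruence) RZ) as HZ2;
        pose proof (H1 Z cZ PZ ltac:(congruence) (refines_trans HSM _ _ _ _ _ _ P2 P1 RZ R2)) as HZ1;
        simpl in HZ1, HZ2; tauto.
  - intros X _ HM x U _ _ (V & HV).
    destruct (basic_fin_below HSM x U V HV) as (cU & n & PU & EU & Hx).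
    pose proof (fin_below_fpath _ _ _ _ _ Hx) as Fx. rewrite EU in Fx.
    assert (Et : shift n cU 0 = cU n) by (unfold shift; f_equal; lia).
    destruct (meager_null HSM X HM x (cU n) (shift n U) (shift n cU) Fx (path_shift _ _ _ PU) Et)
      as (U2 & c2 & P2 & E2 & R2 & H2).
    exists (glue (pre n U) U2). split; [apply (cone_glue HSM x U cU n U2 c2); auto|].
    assert (Fn : fpath (M := M) 0 (pre n U) (cU n)).
    { pose proof (fpath_pre HSM U cU n PU) as F. rewrite EU in F. exact F. }
    intros W HW.
    destruct (basic_glue HSM x (pre n U) (cU n) U2 c2 W Fx Fn P2 E2 HW) as (Z & cZ & PZ & EZ & RZ & ->).
    apply (H2 Z cZ PZ); [congruence|exact RZ].
Qed.
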